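(* Let $m,n\ge 0$ with $p=2m+n>1$, and let $\mathcal{P}$ be the family of simple planar graphs. Then $$3p^2+p+1\le \omega_{r(m,n)}(\mathcal{P})\le 42p^2+8.$$
   Context: An $(m,n)$-colored mixed graph $G$ is obtained from a simple graph $U(G)$ (its underlying graph) by giving each edge either an orientation and one of $m$ arc colors (an arc) or leaving it unoriented with one of $n$ edge colors (an edge). For adjacent $u,v$, the adjacency type of $uv$ is ''arc $u\to v$ of color $i$'', ''arc $v\to u$ of color $i$'', or ''edge of color $j$''; $uv$ and $wx$ have the same adjacency type if both are arcs $u\to v$, $w\to x$ of the same color, or both arcs $v\to u$, $x\to w$ of the same color, or both edges of the same color. A colored homomorphism $f:G\to H$ between $(m,n)$-colored mixed graphs (with simple underlying graphs) is a vertex map such that for each adjacent pair $uv$ of $G$, $f(u)f(v)$ is adjacent in $H$ with the same adjacency type. $R\subseteq V(G)$ is a relative $(m,n)$-clique if no two distinct vertices of $R$ have the same image under any colored homomorphism of $G$. $\omega_{r(m,n)}(G)$ is the maximum size of a relative $(m,n)$-clique of $G$; for a family $\mathcal{F}$ of simple graphs, $\omega_{r(m,n)}(\mathcal{F})$ is the maximum of $\omega_{r(m,n)}(G)$ over all $(m,n)$-colored mixed graphs $G$ with $U(G)\in\mathcal{F}$. A 2-path $uvw$ is special if $uv$ and $vw$ do not have the same adjacency type; it is known that two distinct vertices can never be identified by a colored homomorphism iff they are adjacent or joined by a special 2-path. *)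

(* Defs.v *)
From Stdlib Require Import Reals.
From mathcomp Require Import all_boot.
Set Implicit Arguments. Unset Strict Implicit. Unset Printing Implicit Defensive.

(* Seen from u, the pair uv is: an arc u -> v of color i (AOut i),
   an arc v -> u of color i (AIn i), or an edge of color j (AEdge j). *)
Inductive adj_type (m n : nat) : Type :=
| AOut of 'I_m
| AIn of 'I_m
| AEdge of 'I_n.

Definition flip_type (m n : nat) (a : adj_type m n) : adj_type m n :=
  match a with
  | AOut i => AIn n i
  | AIn i => AOut n i
  | AEdge j => AEdge m j
  end.

Definition simple_graph (T : finType) (e : rel T) : Prop :=
  (forall u, ~~ e u u) /\ (forall u v, e u v = e v u).

(* An (m,n)-colored mixed graph: vertex type T, underlying simple graph e,
   and c u v = adjacency type of uv seen from u (meaningful when e u v),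
   consistent in both directions. *)
Definition colored_mixed_graph (m n : nat) (T : finType) (e : rel T)
    (c : T -> T -> adj_type m n) : Prop :=
  simple_graph e /\ (forall u v, e u v -> c v u = flip_type (c u v)).

Definition colored_hom (m n : nat) (T : finType) (e : rel T) (c : T -> T -> adj_type m n)
    (T' : finType) (e' : rel T') (c' : T' -> T' -> adj_type m n) (f : T -> T') : Prop :=
  forall u v, e u v -> e' (f u) (f v) /\ c' (f u) (f v) = c u v.

Definition relative_clique (m n : nat) (T : finType) (e : rel T)
    (c : T -> T -> adj_type m n) (R : {set T}) : Prop :=
  forall (T' : finType) (e' : rel T') (c' : T' -> T' -> adj_type m n) (f : T -> T'),
    colored_mixed_graph e' c' -> colored_hom e c e' c' f ->
    forall u v, u \in R -> v \in R -> u <> v -> f u <> f v.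

Definition in01 (t : R) : Prop := Rle R0 t /\ Rle t R1.
Definition in01o (t : R) : Prop := Rlt R0 t /\ Rlt t R1.

Definition cont01 (g : R -> R * R) : Prop :=
  forall t, in01 t -> forall eps, Rlt R0 eps -> exists delta, Rlt R0 delta /\
    forall s, in01 s -> Rlt (Rabs (Rminus s t)) delta ->
      Rlt (Rabs (Rminus (fst (g s)) (fst (g t)))) eps /\ Rlt (Rabs (Rminus (snd (g s)) (snd (g t)))) eps.

Definition planar (T : finType) (e : rel T) : Prop :=
  exists (pos : T -> R * R) (arc : T -> T -> R -> R * R),
    injective pos /\
    forall u v, e u v ->
      cont01 (arc u v) /\
          arc u v R0 = pos u /\ arc u v R1 = pos v /\
          (forall s t, in01 s -> in01 t -> arc u v s = arc u v t -> s = t) /\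
          (forall t w, in01o t -> arc u v t <> pos w) /\
          (forall w x, e w x -> ~ ((w = u /\ x = v) \/ (w = v /\ x = u)) ->
             forall s t, in01o s -> in01o t -> arc u v s <> arc w x t).

(* Main.v *)
Require Import Defs.
From Stdlib Require Import Reals Lra Btauto ClassicalEpsilon.
From Coquelicot Require Compactness.
From mathcomp Require Import all_boot zify.
Set Implicit Arguments. Unset Strict Implicit. Unset Printing Implicit Defensive.

(** Upper bound. Seen from a point off a planar arc, the arc crosses a fixed ray with a
    certain parity. For two disjoint arcs the four parities taken from their end points
    are related, because the difference of the two arcs is a map of a square to the
    punctured plane. These relations ([drawable]) survive deletion and contraction of
    edges and are violated by K5 and K33; hence a planar graph has at most 3v - 6 edges
    and no K33, also after contractions.

    The rest is counting the pairs of the clique R, each of which is an edge or the two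
    ends of a special 2-path. Helper vertices outside R are contracted one after the
    other into a neighbour, and the new edges pay for the pairs that the helper serves;
    a middle vertex in R is paid for by its degree. The number of vertices of R that a
    vertex sees through a middle vertex w is bounded by (p - 1) times the size of a
    class of R-neighbours of w of one type; such a class is counted in the same way,
    with 2v - 3 in place of 3v - 6 because w is an apex over it, and with classes of
    vertices having the same types to both w and z, which have at most 3 elements unless
    w and z have at most 5 common neighbours.

    Lower bound. An apex is joined by the j-th type to the j-th of p fans; each fan is a
    hub joined by the i-th type to the i-th of p paths on three vertices, the two ends
    of a path being joined by a special 2-path through its middle. *)

(** * Deletion, contraction and the parity obstruction *)

Lemma addb_xorb (a b : bool) : a (+) b = xorb a b.
Proof. by case: a; case: b. Qed.

(* [k w u v] stands for the parity with which the drawing of the edge uv crosses the ray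
   from w, and [L] for the lexicographic order of the vertex positions. *)
Definition drawable (T : finType) (e : rel T) : Prop :=
  [/\ irreflexive e, symmetric e &
    exists (L : rel T) (k : T -> T -> T -> bool),
    [/\ forall a b, a != b -> L b a = ~~ L a b,
        forall w u v, k w u v = k w v u &
        forall u v w x, e u v -> e w x -> u != w -> u != x -> v != w -> v != x ->
          k w u v (+) k x u v (+) (k u w x (+) k v w x)
          = L w u (+) L x u (+) (L w v (+) L x v)]].

(** The contracted vertex [s] stays in the type as an isolated vertex, so successive contractions
    live on one vertex type. *)
Definition contract (T : finType) (e : rel T) (s a : T) : rel T :=
  fun x y => [&& x != s, y != s, x != y &
                 [|| e x y, (x == a) && e s y | (y == a) && e s x]].

Section Drawable.
Variables (T : finType) (e : rel T).
Hypothesis De : drawable e.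

Lemma drawable_irr : irreflexive e. Proof. by case: De. Qed.
Lemma drawable_sym : symmetric e. Proof. by case: De. Qed.

Lemma drawable_neq x y : e x y -> x != y.
Proof. by apply: contraTneq => ->; rewrite drawable_irr. Qed.

Lemma drawable_sub (e' : rel T) : symmetric e' -> subrel e' e -> drawable e'.
Proof.
case: De => ie se [L [k [HL Hk H]]] se' sub; split=> //.
  by move=> x; apply/negP => /sub; rewrite ie.
by exists L, k; split=> // u v w x /sub uv /sub wx; apply: H.
Qed.

(** A new edge xy follows the path x-s-y and gets the sum of the two parities; adding the identities
    of the two halves cancels all terms at [s]. Two new edges both contain [a], so they are never
    disjoint. *)
Lemma drawable_contract s a : e s a -> drawable (contract e s a).
Proof.
move=> sa; case: De => ie se [L [k [HL Hk H]]].
have cs : symmetric (contract e s a).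
  move=> x y; rewrite /contract [y == x]eq_sym se [X in _ || X]orbC.
  by case: (x != s); case: (y != s).
split=> //; first by move=> x; rewrite /contract eqxx !andbF.
have new x y : contract e s a x y -> ~~ e x y ->
    [&& e x s, e s y & (x == a) || (y == a)].
  case/and4P => _ _ _ /or3P[-> //|/andP[/eqP -> sy] _|/andP[/eqP -> sx] _].
    by rewrite se sa sy eqxx.
  by rewrite sa se sx eqxx orbT.
have ns x y : contract e s a x y -> (x != s) && (y != s).
  by case/and4P => -> ->.
pose k' w x y := if e x y then k w x y else k w x s (+) k w s y.
exists L, k'; split=> //.
  by move=> w u v; rewrite /k' se; case: ifP => // _; rewrite addbC Hk [k w u s]Hk.
have key u v w x : contract e s a u v -> e w x -> w != s -> x != s ->
    u != w -> u != x -> v != w -> v != x ->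
    k' w u v (+) k' x u v (+) (k u w x (+) k v w x)
          = L w u (+) L x u (+) (L w v (+) L x v).
  move=> uv wx ws xs uw ux vw vx; rewrite /k'.
  case: ifPn => [euv|neuv]; first exact: H.
  have /and3P[us sv _] := new _ _ uv neuv.
  have sw : s != w by rewrite eq_sym. have sx : s != x by rewrite eq_sym.
  have E := congr2 addb (H _ _ _ _ us wx uw ux sw sx) (H _ _ _ _ sv wx sw sx vw vx).
  by etransitivity; [|etransitivity; [exact: E|]]; rewrite !addb_xorb; btauto.
move=> u v w x uv wx uw ux vw vx.
have /andP[us vs] := ns _ _ uv; have /andP[ws xs] := ns _ _ wx.
have [ewx|newx] := boolP (e w x).
  by rewrite {3 4}/k' ewx; apply: key.
have [euv|neuv] := boolP (e u v); last first.
  have /and3P[_ _ /orP[]/eqP] := new _ _ uv neuv;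
  have /and3P[_ _ /orP[]/eqP] := new _ _ wx newx => E1 E2; subst;
  by rewrite ?eqxx in uw ux vw vx.
have wu : w != u by rewrite eq_sym. have xu : x != u by rewrite eq_sym.
have wv : w != v by rewrite eq_sym. have xv : x != v by rewrite eq_sym.
(* An old edge against a new one: exchanging their roles negates four values of [L], which preserves
   the sum. *)
have := key _ _ _ _ wx euv us vs wu wv xu xv.
rewrite [k' w _ _]/k' [k' x _ _]/k' euv addbC => ->.
rewrite (HL _ _ wu) (HL _ _ wv) (HL _ _ xu) (HL _ _ xv).
by do 4 case: (L _ _).
Qed.
End Drawable.

Section Parity.
Variables (T : finType) (e : rel T).
Hypothesis De : drawable e.

(* For a fixed tournament on the vertices, the right-hand sides of the defining
   identity of [drawable] add up to 1 over all pairs of disjoint edges of K5 or of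
   K33, while on the left every term occurs an even number of times. *)
Lemma drawable_no_K5 (a b c d f : T) :
  [&& e a b, e a c, e a d, e a f & e b c] ->
  [&& e b d, e b f, e c d, e c f & e d f] -> False.
Proof.
move=> /and5P[ab ac ad af bc] /and5P[bd bf cd cf df].
have Nab := drawable_neq De ab. have Nac := drawable_neq De ac.
have Nad := drawable_neq De ad. have Naf := drawable_neq De af.
have Nbc := drawable_neq De bc. have Nbd := drawable_neq De bd.
have Nbf := drawable_neq De bf. have Ncd := drawable_neq De cd.
have Ncf := drawable_neq De cf. have Ndf := drawable_neq De df.
case: De => _ _ [L [k [HL _ H]]].
pose D u v w x := k w u v (+) k x u v (+) (k u w x (+) k v w x)
          (+) (L w u (+) L x u (+) (L w v (+) L x v)).
have D0 u v w x : e u v -> e w x -> [&& u != w, u != x, v != w & v != x] ->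
    D u v w x = false.
  by move=> uv wx /and4P[? ? ? ?]; rewrite /D H // addbb.
have : D a b c d (+) D a b c f (+) D a b d f (+) D a c b d (+) D a c b f (+)
  D a c d f (+) D a d b c (+) D a d b f (+) D a d c f (+) D a f b c (+) D a f b d (+)
  D a f c d (+) D b c d f (+) D b d c f (+) D b f c d = true.
  rewrite /D (HL _ _ Nab) (HL _ _ Nac) (HL _ _ Nad) (HL _ _ Naf) (HL _ _ Nbc).
  rewrite (HL _ _ Nbd) (HL _ _ Nbf) (HL _ _ Ncd) (HL _ _ Ncf) (HL _ _ Ndf).
  rewrite !addb_xorb; btauto.
by rewrite !D0 // ?(eq_sym d b) ?(eq_sym c b) ?(eq_sym d c) ?(eq_sym f b)
  ?(eq_sym f c) ?(eq_sym f d) ?Nab ?Nac ?Nad ?Naf ?Nbc ?Nbd ?Nbf ?Ncd ?Ncf ?Ndf.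
Qed.

Lemma drawable_no_K33 (a1 a2 a3 b1 b2 b3 : T) :
  uniq [:: a1; a2; a3] -> uniq [:: b1; b2; b3] ->
  {in [:: a1; a2; a3] & [:: b1; b2; b3], forall a b, e a b} -> False.
Proof.
rewrite /= !inE !andbT !negb_or => /andP[/andP[Na12 Na13] Na23].
move=> /andP[/andP[Nb12 Nb13] Nb23] eab.
have nab a b : a \in [:: a1; a2; a3] -> b \in [:: b1; b2; b3] -> a != b.
  by move=> ha hb; apply: (drawable_neq De); apply: eab.
case: De => _ _ [L [k [HL Hk H]]].
pose D u v w x := k w u v (+) k x u v (+) (k u w x (+) k v w x)
          (+) (L w u (+) L x u (+) (L w v (+) L x v)).
have D0 u v w x : [&& u \in [:: a1; a2; a3], v \in [:: b1; b2; b3],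
    w \in [:: a1; a2; a3] & x \in [:: b1; b2; b3]] -> (u != w) && (v != x) ->
    D u v w x = false.
  move=> /and4P[hu hv hw hx] /andP[uw vx]; rewrite /D H ?addbb ?eab //; first exact: nab.
  by rewrite eq_sym; apply: nab.
have : D a1 b1 a2 b2 (+) D a1 b1 a2 b3 (+) D a1 b2 a2 b1 (+) D a1 b2 a2 b3 (+)
  D a1 b3 a2 b1 (+) D a1 b3 a2 b2 (+) D a1 b1 a3 b2 (+) D a1 b1 a3 b3 (+)
  D a1 b2 a3 b1 (+) D a1 b2 a3 b3 (+) D a1 b3 a3 b1 (+) D a1 b3 a3 b2 (+)
  D a2 b1 a3 b2 (+) D a2 b1 a3 b3 (+) D a2 b2 a3 b1 (+) D a2 b2 a3 b3 (+)
  D a2 b3 a3 b1 (+) D a2 b3 a3 b2 = true.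
  rewrite /D (HL _ _ Na12) (HL _ _ Na13) (HL _ _ Na23).
  rewrite (HL _ _ Nb12) (HL _ _ Nb13) (HL _ _ Nb23).
  rewrite !addb_xorb; btauto.
by rewrite !D0 // ?inE ?eqxx ?orbT // ?(eq_sym b2 b1) ?(eq_sym b3 b1) ?(eq_sym b3 b2)
  ?Na12 ?Na13 ?Na23 ?Nb12 ?Nb13 ?Nb23.
Qed.
End Parity.

(** * The edge bound *)

Definition nbr (T : finType) (e : rel T) (A : {set T}) (v : T) : {set T} :=
  [set x in A | e v x].

Definition narcs (T : finType) (e : rel T) (A : {set T}) : nat :=
  \sum_(v in A) #|nbr e A v|.

Section Counting.
Variables (T : finType).
Implicit Types (e : rel T) (A X : {set T}).

Lemma in_nbr e A v x : (x \in nbr e A v) = (x \in A) && e v x.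
Proof. by rewrite inE. Qed.

Lemma nbr_sub e A v : nbr e A v \subset A.
Proof. by apply/subsetP=> x; rewrite in_nbr => /andP[]. Qed.

Lemma card_nbr_le e A v : irreflexive e -> v \in A -> #|nbr e A v| < #|A|.
Proof.
move=> ie vA; apply: proper_card; rewrite properE nbr_sub; apply/subsetPn.
by exists v => //; rewrite in_nbr ie andbF.
Qed.

Lemma sum_const_in A (c : nat) : \sum_(v in A) c = c * #|A|.
Proof. by rewrite sum_nat_const mulnC. Qed.

Lemma narcs_D1 e A v : symmetric e -> irreflexive e -> v \in A ->
  narcs e A = narcs e (A :\ v) + 2 * #|nbr e A v|.
Proof.
move=> se ie vA; rewrite /narcs (big_setD1 v) //=.
rewrite (eq_bigr (fun u => #|nbr e (A :\ v) u| + (e v u : nat))); last first.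
  move=> u; rewrite !inE => /andP[uv uA].
  rewrite (cardsD1 v (nbr e A u)) in_nbr vA se addnC; congr (_ + _).
  by apply: eq_card => x; rewrite !inE andbA.
rewrite big_split /=.
have -> : \sum_(u in A :\ v) (e v u : nat) = #|nbr e A v|.
  rewrite -big_mkcondr /= sum1dep_card; apply: eq_card => x.
  by rewrite !inE; case: (eqVneq x v) => [->|_] //=; rewrite ie andbF.
lia.
Qed.

Lemma narcs_contract_gain e X s a : drawable e -> a \in X -> s \notin X -> e s a ->
  narcs e X + 2 * #|[set y in X | [&& e s y, y != a & ~~ e a y]]|
    <= narcs (contract e s a) X.
Proof.
move=> De aX sX sa; set Y := [set _ in _ | _].
have aY : a \notin Y by rewrite !inE eqxx !andbF.
have YX : Y \subset X by apply/subsetP=> y; rewrite inE => /andP[].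
have nX y : y \in X -> y != s by apply: contraTneq => ->.
pose f u := #|nbr e X u| + ((u \in Y : nat) + (u == a) * #|Y|).
have -> : narcs e X + 2 * #|Y| = \sum_(u in X) f u.
  rewrite /f !big_split /=; congr (_ + _); rewrite mul2n -addnn; congr (_ + _).
    rewrite -big_mkcondr /= sum1dep_card; apply: eq_card => u.
    by rewrite inE; apply/idP/idP => [h|/andP[] //]; rewrite h (subsetP YX).
  rewrite (bigD1 a) //= eqxx mul1n big1 ?addn0 // => u /andP[_ /negPf ->].
  by rewrite mul0n.
apply: leq_sum => u uX; rewrite /f.
have sub : nbr e X u \subset nbr (contract e s a) X u.
  apply/subsetP=> x; rewrite !in_nbr /contract => /andP[xX ux].
  by rewrite xX ux !nX // (drawable_neq De ux).
have [E|ua] := eqVneq u a.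
  rewrite {}E in sub *; rewrite (negPf aY) mul1n add0n.
  have <- : #|nbr e X a :|: Y| = #|nbr e X a| + #|Y|.
    rewrite cardsU (_ : nbr e X a :&: Y = set0) ?cards0 ?subn0 //.
    by apply/setP=> x; rewrite !inE; case: (e a x); rewrite ?andbF.
  apply/subset_leq_card/subsetP=> x; rewrite in_setU => /orP[|xY].
    exact: (subsetP sub).
  move: xY; rewrite !inE => /and4P[xX sx xa ax].
  by rewrite xX /contract !nX // eq_sym xa eqxx sx orbT.
rewrite addn0; case: (boolP (u \in Y)) => uY; last by rewrite addn0 subset_leq_card.
have <- : #|a |: nbr e X u| = #|nbr e X u| + 1.
  rewrite cardsU1 in_nbr (drawable_sym De) aX.
  by move: uY; rewrite !inE => /and4P[_ _ _ ->]; rewrite addnC.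
apply/subset_leq_card/subsetP=> x; rewrite in_setU1 => /orP[/eqP->|]; last first.
  by move=> h; apply: (subsetP sub).
move: uY; rewrite !inE => /and4P[_ su _ _].
by rewrite aX /contract !nX // ua eqxx su !orbT.
Qed.

(** The contraction loses the edge sa and, for each common neighbour, one of two parallel edges;
    every other edge at [s] survives at [a]. *)
Lemma narcs_contract e A s a : drawable e -> a \in A -> s \in A -> e s a ->
  narcs e A <= narcs (contract e s a) (A :\ s) + 2 + 2 * #|nbr e A s :&: nbr e A a|.
Proof.
move=> De aA sA sa; have ie := drawable_irr De; have se := drawable_sym De.
have aA' : a \in A :\ s by rewrite !inE aA eq_sym (drawable_neq De sa).
have := narcs_contract_gain De aA' (negbT (setD11 _ _)) sa.
set Y := [set _ in _ | _]; rewrite (narcs_D1 se ie sA) => h.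
suff : #|nbr e A s| <= #|Y| + 1 + #|nbr e A s :&: nbr e A a| by lia.
suff : #|nbr e A s| <= #|Y :|: [set a] :|: (nbr e A s :&: nbr e A a)|.
  by rewrite !cardsU cards1; lia.
apply/subset_leq_card/subsetP=> x; rewrite !inE => /andP[xA sx].
have xs : x != s by rewrite eq_sym (drawable_neq De sx).
rewrite xA sx xs /=.
by case: (x == a) => //=; case: (e a x).
Qed.

Lemma drawable_not_complete5 e A : drawable e -> #|A| = 5 ->
  exists2 x, x \in A & exists2 y, y \in A & (x != y) && ~~ e x y.
Proof.
move=> De cA.
suff /exists_inP[x xA /exists_inP[y yA h]] :
  [exists x in A, exists y in A, (x != y) && ~~ e x y] by exists x => //; exists y.
apply: contraT => /exists_inPn H.
have eA x y : x \in A -> y \in A -> x != y -> e x y.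
  move=> xA yA xy; have /exists_inPn/(_ y yA) := H x xA.
  by rewrite xy /= negbK.
have mA x : x \in enum A -> x \in A by rewrite mem_enum.
move: cA (enum_uniq A) mA; rewrite cardE.
case: (enum A) => [|a [|b [|c [|d [|f []]]]]] //= _.
rewrite !inE !negb_or !andbT => /and4P[/and4P[ab ac ad af] /and3P[bc bd bf] /andP[cd cf] df] mA.
have [aA bA cA dA fA] : [/\ a \in A, b \in A, c \in A, d \in A & f \in A].
  by split; apply: mA; rewrite !inE eqxx ?orbT.
by exfalso; apply: (drawable_no_K5 De (a:=a) (b:=b) (c:=c) (d:=d) (f:=f));
  rewrite !eA.
Qed.

Definition del_edge e (u v : T) : rel T :=
  fun x y => e x y && ~~ ((x == u) && (y == v) || (x == v) && (y == u)).

Lemma drawable_del_edge e u v : drawable e -> drawable (del_edge e u v).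
Proof.
move=> De; apply: (drawable_sub De) => [x y|x y /andP[] //].
rewrite /del_edge (drawable_sym De) orbC.
by rewrite [(y == u) && _]andbC [(y == v) && _]andbC.
Qed.

Lemma narcs_del_edge e A u v : u != v -> u \in A -> v \in A -> e u v ->
  narcs (del_edge e u v) A < narcs e A <= narcs (del_edge e u v) A + 2.
Proof.
move=> uv uA vA euv.
have sub x : nbr (del_edge e u v) A x \subset nbr e A x.
  by apply/subsetP=> y; rewrite !in_nbr => /and3P[-> ->].
apply/andP; split.
  rewrite /narcs (bigD1 u) //= [X in _ < X](bigD1 u) //=.
  rewrite -addSn; apply: leq_add; last by apply: leq_sum => x _; apply: subset_leq_card.
  apply: proper_card; rewrite properE sub; apply/subsetPn; exists v.
    by rewrite in_nbr vA euv.
  by rewrite in_nbr /del_edge !eqxx /= andbF andbF.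
have -> : narcs (del_edge e u v) A + 2 =
    \sum_(x in A) (#|nbr (del_edge e u v) A x| + ((x == u) + (x == v))).
  rewrite !big_split /=; congr (_ + _).
  rewrite (bigD1 u) //= eqxx big1 => [|x /andP[_ /negPf-> //]].
  by rewrite (bigD1 v) //= eqxx big1 => [|x /andP[_ /negPf-> //]].
apply: leq_sum => x _; have [xu|xu] := eqVneq x u.
  rewrite xu (negPf uv) addn0 (cardsD1 v) addnC leq_add //; last by case: (_ \in _).
  apply/subset_leq_card/subsetP=> y; rewrite !inE /del_edge => /and3P[yv -> ->].
  by rewrite (negPf yv) (negPf uv) andbF.
have [xv|xv] := eqVneq x v.
  rewrite (cardsD1 u) addnC leq_add //; last by case: (_ \in _).
  apply/subset_leq_card/subsetP=> y; rewrite !inE /del_edge => /and3P[yv -> ->].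
  by rewrite (negPf yv) (negPf xu) andbF.
rewrite addn0; apply/subset_leq_card/subsetP=> y; rewrite !in_nbr /del_edge.
by rewrite (negPf xu) (negPf xv) => /andP[-> ->].
Qed.

Lemma exists_le_average A (F : T -> nat) (c : nat) :
  \sum_(v in A) F v < c * #|A| -> exists2 v, v \in A & F v < c.
Proof.
move=> h; suff /exists_inP[v vA Fv] : [exists v in A, F v < c] by exists v.
apply: contraLR h => /exists_inPn H; rewrite -leqNgt -sum_const_in.
by apply: leq_sum => v vA; rewrite leqNgt H.
Qed.

(* In a minimal counterexample contraction forces every edge into three triangles, and
   then the closed neighbourhood of a vertex of degree at most 5 has too many edges. *)
Lemma narcs_le e A : drawable e -> 2 < #|A| -> narcs e A + 12 <= 6 * #|A|.
Proof.
have [M] := ubnP #|A|; elim: M e A => // M IH e A ltM.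
have [N] := ubnP (narcs e A); elim: N e => // N IHN e ltN De A3.
have ie := drawable_irr De; have se := drawable_sym De.
have dle v : v \in A -> #|nbr e A v| <= #|A|.-1.
  by move=> vA; have := card_nbr_le ie vA; lia.
have tot : narcs e A <= #|A|.-1 * #|A|.
  by rewrite -sum_const_in; apply: leq_sum.
have [A4|A5] := leqP #|A| 4; first by move: tot; nia.
(* On five vertices a non-adjacent pair leaves at most 3 + 3 + 3 * 4 = 18 arcs. *)
have [A6|A6] := leqP #|A| 5.
  have cA : #|A| = 5 by lia.
  have [x xA [y yA /andP[xy nxy]]] := drawable_not_complete5 De cA.
  have dle' u v : u \in A -> v \in A -> u != v -> ~~ e u v -> #|nbr e A u| <= 3.
    move=> uA vA uv nuv; apply: (@leq_trans #|A :\ u :\ v|).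
      apply/subset_leq_card/subsetP=> z; rewrite !inE => /andP[zA uz].
      rewrite zA (contraNneq _ nuv) => [|<- //].
      by rewrite eq_sym (drawable_neq De uz).
    have := cardsD1 u A; have := cardsD1 v (A :\ u).
    by rewrite !inE uA vA eq_sym uv cA /=; lia.
  rewrite /narcs (bigD1 x) //= (bigD1 y) /=; last by rewrite yA eq_sym.
  have h1 := dle' _ _ xA yA xy nxy.
  have h2 : #|nbr e A y| <= 3 by apply: (dle' y x) => //; [rewrite eq_sym | rewrite se].
  rewrite (eq_bigl (fun i => i \in A :\ x :\ y)); last first.
    by move=> i; rewrite !inE andbC [(i \in A) && _]andbC.
  suff : \sum_(i in A :\ x :\ y) #|nbr e A i| <= 12 by lia.
  apply: (@leq_trans (\sum_(i in A :\ x :\ y) 4)).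
    by apply: leq_sum => i; rewrite !inE => /and3P[_ _ iA]; rewrite -[4]/(5.-1) -cA dle.
  rewrite sum_const_in; have := cardsD1 x A; have := cardsD1 y (A :\ x).
  by rewrite !inE xA yA eq_sym xy cA /=; lia.
rewrite leqNgt; apply/negP => big.
(* The inner induction gives the bound after deleting one edge, so it is exceeded by at most two
   arcs. *)
have small : narcs e A + 10 <= 6 * #|A|.
  have [v vA dv] : exists2 v, v \in A & 0 < #|nbr e A v|.
    suff /exists_inP[v vA Fv] : [exists v in A, 0 < #|nbr e A v|] by exists v.
    apply: contraLR big => /exists_inPn H; rewrite -leqNgt /narcs big1 => [|v vA].
      lia.
    by have := H v vA; lia.
  have /card_gt0P[u] := dv; rewrite in_nbr => /andP[uA vu].
  have /andP[lt le] := narcs_del_edge (drawable_neq De vu) vA uA vu.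
  have := IHN _ _ (drawable_del_edge v u De) A3; lia.
have deg4 v : v \in A -> 3 < #|nbr e A v|.
  move=> vA; have := narcs_D1 se ie vA; have := cardsD1 v A; rewrite vA => cv nv.
  have := IH e (A :\ v) _ De _; lia.
have com u v : u \in A -> v \in A -> e u v -> 2 < #|nbr e A u :&: nbr e A v|.
  move=> uA vA uv; have h := narcs_contract De vA uA uv.
  have := cardsD1 u A; rewrite uA => cu.
  have := IH _ (A :\ u) _ (drawable_contract De uv) _; lia.
(* Degree at most 4 on six vertices, since 26 < 5 * 6, and at most 5 on more: the closed
   neighbourhood is then smaller than [A] and the outer induction applies to it. *)
have [v vA dv] : exists2 v, v \in A & #|nbr e A v| < 5 + (6 < #|A|).
  by apply: exists_le_average; rewrite -/(narcs e A); case: ltnP => /=; lia.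
have d4 := deg4 v vA.
set B := v |: nbr e A v.
have vB : v \notin nbr e A v by rewrite in_nbr ie andbF.
have cB : #|B| = (#|nbr e A v|).+1 by rewrite cardsU1 vB.
have BA : B \subset A by rewrite subUset sub1set vA nbr_sub.
have : 5 * #|nbr e A v| <= narcs e B.
  rewrite /narcs big_setU1 //= mulSn.
  apply: leq_add.
    apply/subset_leq_card/subsetP=> x xN; rewrite in_nbr in_setU1 xN orbT.
    by move: xN; rewrite in_nbr => /andP[].
  rewrite -sum_const_in; apply: leq_sum => u; rewrite in_nbr => /andP[uA vu].
  apply: (@leq_trans #|v |: (nbr e A v :&: nbr e A u)|).
    by rewrite cardsU1 in_setI (negPf vB) /= ltnS com.
  apply/subset_leq_card/subsetP=> x; rewrite !inE.
  case/orP=> [/eqP->|/andP[/andP[-> ->] /andP[_ ->]]]; last by rewrite orbT.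
  by rewrite eqxx se.
(* For the degree d of [v], 5d + 12 <= 6(d + 1) would force d >= 6. *)
have := IH e B _ De _; rewrite cB; move: dv.
have : #|B| <= #|A| := subset_leq_card BA.
case: ltnP => /=; lia.
Qed.
End Counting.

(** * Common neighbours of two vertices *)

Section TwoPoles.
Variables (T : finType) (w z : T) (Y : {set T}).
Hypothesis wz : w != z.
Implicit Types (e : rel T).

Definition poles e := forall y, y \in Y -> e w y /\ e z y.

(** The vertices [w], [z], [u] against the three neighbours form a K33. Hence a vertex other than
    the poles has at most two neighbours in [Y]. *)
Lemma poles_no3 e u x1 x2 x3 : drawable e -> poles e -> u != w -> u != z ->
  uniq [:: x1; x2; x3] -> {subset [:: x1; x2; x3] <= nbr e Y u} -> False.
Proof.
move=> De P uw uz un sub.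
apply: (drawable_no_K33 De (a1 := w) (a2 := z) (a3 := u) _ un).
  by rewrite /= !inE negb_or wz ![_ == u]eq_sym uw uz.
move=> a b Ha /sub; rewrite in_nbr => /andP[bY ub].
by move: Ha; rewrite !inE => /or3P[]/eqP->; have [] := P b bY.
Qed.

(** By [poles_no3] a helper has at most two neighbours in [Y], so contracting it into one of them
    makes its only pair adjacent. *)
Lemma contract_helpers e (S : {set T}) : drawable e -> poles e ->
  (forall s, s \in S -> [&& s \notin Y, s != w & s != z]) ->
  exists e', [/\ drawable e', poles e' &
    forall x y, x \in Y -> y \in Y -> x != y ->
      e x y \/ (exists2 u, u \in S & e u x && e u y) -> e' x y].
Proof.
have [n] := ubnP #|S|; elim: n S e => // n IH S e ltS De P HS.
have [S0|[s sS]] := set_0Vmem S.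
  by exists e; split=> // x y _ _ _ [//|[u]]; rewrite S0 inE.
have /and3P[sY sw sz] := HS s sS.
have lt' : #|S :\ s| < n by have := cardsD1 s S; rewrite sS; lia.
have HS' u : u \in S :\ s -> [&& u \notin Y, u != w & u != z].
  by rewrite inE => /andP[_ /HS].
have [N1|] := leqP #|nbr e Y s| 1.
  have [e' [De' P' H']] := IH _ e lt' De P HS'.
  exists e'; split=> // x y xY yY xy [exy|[u uS /andP[ux uy]]]; apply: H' => //.
    by left.
  right; exists u; rewrite ?ux ?uy //= !inE uS andbT.
  apply: contraTneq N1 => us; rewrite -ltnNge; apply/card_gt1P; exists x, y.
  by rewrite xy !in_nbr xY yY -us ux uy.
move=> /(leq_trans (leqnSn 1))/card_gt0P[a aN].
have /andP[aY sa] : (a \in Y) && e s a by rewrite -in_nbr.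
have D1 := drawable_contract De sa.
have sub x y : x != s -> y != s -> e x y -> contract e s a x y.
  by move=> xs ys xy; rewrite /contract xs ys xy (drawable_neq De xy).
have nY y : y \in Y -> y != s by apply: contraTneq => ->.
have P1 : poles (contract e s a).
  have [ws zs] : w != s /\ z != s by rewrite ![_ == s]eq_sym.
  by move=> y yY; have [wy zy] := P y yY; split; apply: sub => //; apply: nY.
have [e' [De' P' H']] := IH _ _ lt' D1 P1 HS'.
exists e'; split=> // x y xY yY xy H; apply: H' => //.
case: H => [exy|[u uS /andP[ux uy]]]; first by left; apply: sub; rewrite ?nY.
have [us|us] := eqVneq u s; last first.
  right; exists u; first by rewrite !inE us.
  by apply/andP; split; apply: sub => //; apply: nY.
left; rewrite us in ux uy.
rewrite /contract !nY // xy ux uy !andbT.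
have [|xa] := eqVneq x a; first by rewrite orbT.
have [|ya] := eqVneq y a; first by rewrite !orbT.
exfalso; apply: (poles_no3 (u := s) (x1 := a) (x2 := x) (x3 := y) De P sw sz).
  by rewrite /= !inE negb_or xy ![a == _]eq_sym xa ya.
by move=> t; rewrite !inE => /or3P[]/eqP->; rewrite ?xY ?yY ?ux ?uy // aY.
Qed.

Lemma narcs_ge_min_deg e (C : {set T}) (d : nat) :
  (forall x, x \in C -> d <= #|nbr e C x|) -> d * #|C| <= narcs e C.
Proof. by move=> H; rewrite -sum_const_in; apply: leq_sum. Qed.

(* Contracting y into w makes the poles adjacent. *)
Lemma poles_acyclic e (C : {set T}) y : drawable e -> poles e ->
  C \subset Y -> y \in Y -> y \notin C -> 0 < #|C| -> narcs e C < 2 * #|C|.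
Proof.
move=> De P CY yY yC C0; have [wy zy] := P y yY.
have se := drawable_sym De.
have yw : e y w by rewrite se.
have D1 := drawable_contract De yw; set e1 := contract e y w in D1.
have nY x : x \in Y -> (x != w) && (x != z).
  move=> xY; have [wx zx] := P x xY.
  by rewrite ![x == _]eq_sym (drawable_neq De wx) (drawable_neq De zx).
have sub u v : u != y -> v != y -> e u v -> e1 u v.
  by move=> us vs uv; rewrite /e1 /contract us vs uv (drawable_neq De uv).
have /andP[yw' yz'] := nY y yY.
have yz : e1 w z.
  by rewrite /e1 /contract wz eqxx (se y z) zy orbT (eq_sym w y) (eq_sym z y) yw' yz'.
have wC : w \notin C by apply/negP => /(subsetP CY)/nY; rewrite eqxx.
have zC : z \notin C by apply/negP => /(subsetP CY)/nY; rewrite eqxx andbF.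
have yC' x : x \in C -> x != y by apply: contraTneq => ->.
set B1 := z |: C; set B := w |: B1.
have wB1 : w \notin B1 by rewrite !inE negb_or wz.
have BD1 : B :\ w = B1 by rewrite setU1K.
have B1D1 : B1 :\ z = C by rewrite setU1K.
have cB1 : #|B1| = #|C|.+1 by rewrite cardsU1 zC.
have cB : #|B| = #|B1|.+1 by rewrite cardsU1 wB1.
have i1 := drawable_irr D1; have s1 := drawable_sym D1.
have E := narcs_D1 s1 i1 (setU11 w B1); rewrite BD1 in E.
have E' := narcs_D1 s1 i1 (setU11 z C); rewrite B1D1 in E'.
have dw : #|B1| <= #|nbr e1 B w|.
  apply/subset_leq_card/subsetP=> x xB; rewrite in_nbr inE xB orbT /=.
  move: xB; rewrite in_setU1 => /orP[/eqP-> //|xC].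
  by apply: sub; [rewrite eq_sym | exact: yC' | have [] := P x (subsetP CY x xC)].
have dz : #|C| <= #|nbr e1 B1 z|.
  apply/subset_leq_card/subsetP=> x xC; rewrite in_nbr inE xC orbT /=.
  by apply: sub; [rewrite eq_sym | exact: yC' | have [] := P x (subsetP CY x xC)].
have le : narcs e C <= narcs e1 C.
  apply: leq_sum => x xC; apply/subset_leq_card/subsetP=> v.
  by rewrite !in_nbr => /andP[vC xv]; rewrite vC; apply: sub => //; apply: yC'.
(* At least 2(|C| + 1) + 2|C| of the at most 6|C| arcs on [B] are at the poles, so fewer than 2|C|
   remain for [C]. *)
have : narcs e1 B + 12 <= 6 * #|B|.
  by apply: narcs_le => //; rewrite cB cB1; case: #|C| C0.
rewrite -/B in E; rewrite -/B1 in E'; clear -E E' dw dz le cB cB1; lia.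
Qed.

Section Near.
Variables (e : rel T) (Z : {set T}).
Hypotheses (De : drawable e) (P : poles e) (Y5 : 5 < #|Y|) (ZY : Z \subset Y).
Hypothesis near : forall x y, x \in Z -> y \in Z -> x != y ->
  e x y \/ exists2 u, u \in Y & e x u && e u y.

Let se : symmetric e := drawable_sym De.
Let inY x : x \in Z -> x \in Y := subsetP ZY x.

Lemma near_no3 u x1 x2 x3 : u \in Y -> [/\ x1 \in Y, x2 \in Y & x3 \in Y] ->
  [/\ e u x1, e u x2 & e u x3] -> [/\ x1 != x2, x1 != x3 & x2 != x3] -> False.
Proof.
move=> uY [Y1 Y2 Y3] [e1 e2 e3] [n12 n13 n23]; have [wu zu] := P uY.
apply: (poles_no3 (u := u) (x1 := x1) (x2 := x2) (x3 := x3) De P).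
- by rewrite eq_sym (drawable_neq De wu).
- by rewrite eq_sym (drawable_neq De zu).
- by rewrite /= !inE negb_or n12 n13 n23.
by move=> t; rewrite !inE => /or3P[]/eqP->; apply/andP.
Qed.

(** As [Y] has more than five elements, one of them lies outside [C], and [poles_acyclic] leaves
    fewer than |C| edges in [C], too few for minimum degree two. *)
Lemma near_no_cycle (C : {set T}) : C \subset Y -> 0 < #|C| <= 5 ->
  (forall x, x \in C -> 1 < #|nbr e C x|) -> False.
Proof.
move=> CY /andP[C0 C5] deg.
have /subsetPn[y yY yC] : ~~ (Y \subset C).
  by apply: contraL Y5 => /subset_leq_card; lia.
by have := poles_acyclic De P CY yY yC C0; have := narcs_ge_min_deg deg; lia.
Qed.

(** The ends of the path are adjacent or have a common neighbour in [Y], which closes a cycle of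
    length four or five. *)
Lemma near_no_path4 f a n m : [/\ f \in Z, a \in Z, n \in Z & m \in Z] ->
  uniq [:: f; a; n; m] -> [/\ e f a, e a n & e n m] -> False.
Proof.
move=> [fZ aZ nZ mZ] un [fa an nm].
have := un; rewrite /= !inE !negb_or !andbT.
move=> /and3P[/and3P[Nfa Nfn Nfm] /andP[Nan Nam] Nnm].
have nam : ~~ e a m.
  by apply/negP => am; apply: (near_no3 (u := a) (x1 := f) (x2 := n) (x3 := m));
    rewrite ?inY ?(se a f).
have nfn : ~~ e f n.
  apply/negP => fn; apply: (near_no3 (u := n) (x1 := f) (x2 := a) (x3 := m));
    by rewrite ?inY ?(se n f) ?(se n a).
have two (C : {set T}) x p q : p \in C -> q \in C -> p != q -> e x p -> e x q -> 1 < #|nbr e C x|.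
  by move=> pC qC pq xp xq; apply/card_gt1P; exists p, q; rewrite !in_nbr pC qC xp xq.
have [fm|[g gY /andP[fg gm]]] := near fZ mZ Nfm.
  apply: (near_no_cycle (C := [set x in [:: f; a; n; m]])).
  - by apply/subsetP=> x; rewrite !inE => /or4P[]/eqP->; apply: inY.
  - rewrite cardsE (card_uniqP un) //.
  move=> x; rewrite !inE => /or4P[]/eqP->.
  - by apply: (two _ _ a m); rewrite ?inE ?eqxx ?orbT.
  - by apply: (two _ _ f n); rewrite ?inE ?eqxx ?orbT // se.
  - by apply: (two _ _ a m); rewrite ?inE ?eqxx ?orbT // se.
  - by apply: (two _ _ f n); rewrite ?inE ?eqxx ?orbT // se.
have Nga : g != a by apply: contraTneq gm => ->.
have Ngn : g != n by apply: contraTneq fg => ->.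
have Ngf := drawable_neq De fg. have Ngm := drawable_neq De gm.
apply: (near_no_cycle (C := [set x in [:: g; f; a; n; m]])).
- by apply/subsetP=> x; rewrite !inE => /or4P[/eqP-> //|/eqP->|/eqP->|/orP[]/eqP->]; apply: inY.
- rewrite cardsE; have /card_uniqP -> // : uniq [:: g; f; a; n; m].
  by rewrite cons_uniq un !inE !negb_or Nga Ngn Ngm eq_sym Ngf.
move=> x; rewrite !inE => /or4P[/eqP->|/eqP->|/eqP->|/orP[]/eqP->].
- by apply: (two _ _ f m); rewrite ?inE ?eqxx ?orbT // se.
- by apply: (two _ _ a g); rewrite ?inE ?eqxx ?orbT // eq_sym.
- by apply: (two _ _ f n); rewrite ?inE ?eqxx ?orbT // se.
- by apply: (two _ _ a m); rewrite ?inE ?eqxx ?orbT // se.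
- by apply: (two _ _ n g); rewrite ?inE ?eqxx ?orbT // 1?se // eq_sym.
Qed.

(** The middle vertex [n] admits no third neighbour, so [f] is near [n] only through an end of the
    path, which extends it to four vertices. *)
Lemma near_no_path3 a n m f : [/\ a \in Z, n \in Z, m \in Z & f \in Z] ->
  uniq [:: a; n; m; f] -> e a n -> e n m -> False.
Proof.
move=> [aZ nZ mZ fZ]; rewrite /= !inE !negb_or !andbT.
move=> /and3P[/and3P[Nan Nam Naf] /andP[Nnm Nnf] Nmf] an nm.
have Nfn : f != n by rewrite eq_sym.
have na : e n a by rewrite se.
have [fn|[u uY /andP[fu un]]] := near fZ nZ Nfn.
  apply: (near_no3 (u := n) (x1 := a) (x2 := m) (x3 := f)); rewrite ?inY //.
  by rewrite (se n f).
have [ua|Nua] := eqVneq u a.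
  rewrite ua in fu; apply: (near_no_path4 (f := f) (a := a) (n := n) (m := m)) => //.
  by rewrite /= !inE !negb_or ![f == _]eq_sym Naf Nnf Nmf Nan Nam Nnm.
have [um|Num] := eqVneq u m.
  rewrite um in fu.
  apply: (near_no_path4 (f := f) (a := m) (n := n) (m := a)) => //.
    by rewrite /= !inE !negb_or ![f == _]eq_sym (eq_sym m n) (eq_sym m a)
      (eq_sym n a) Naf Nnf Nmf Nan Nam Nnm.
  by rewrite (se m n).
apply: (near_no3 (u := n) (x1 := a) (x2 := m) (x3 := u)); first exact: inY.
- by split=> //; apply: inY.
- by rewrite (se n u).
- by rewrite ![_ == u]eq_sym.
Qed.

(** From [a] each of three other vertices is reached through a neighbour of [a] in [Y], possibly
    itself. There are at most two such neighbours, so two targets share one; it then has degree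
    three, or it is a target and the middle of a path in [Z]. *)
Lemma near_card : #|Z| <= 3.
Proof.
rewrite leqNgt; apply/negP => Z4.
have mZ x : x \in enum Z -> x \in Z by rewrite mem_enum.
move: Z4 (enum_uniq Z) mZ; rewrite cardE.
case: (enum Z) => [|a [|b [|c [|d r]]]] // _ un mZ.
have [aZ bZ cZ dZ] : [/\ a \in Z, b \in Z, c \in Z & d \in Z].
  by split; apply: mZ; rewrite !inE eqxx ?orbT.
have : uniq [:: a; b; c; d].
  by move: un; rewrite -[_ :: _]/([:: a; b; c; d] ++ r) cat_uniq => /andP[].
rewrite /= !inE !negb_or !andbT.
move=> /and3P[/and3P[Nab Nac Nad] /andP[Nbc Nbd] Ncd].
have mid x : x \in Z -> a != x -> exists2 u, u \in Y & e a u /\ (x = u \/ e u x).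
  move=> xZ ax; have [ex|[u uY /andP[au ux]]] := near aZ xZ ax.
    by exists x; [exact: inY | split=> //; left].
  by exists u => //; split=> //; right.
have same u x y f : u \in Y -> e a u -> (x = u \/ e u x) -> (y = u \/ e u y) ->
    [/\ x \in Z, y \in Z & f \in Z] -> uniq [:: a; x; y; f] -> False.
  move=> uY au hx hy [xZ yZ fZ] U.
  have := U; rewrite /= !inE !negb_or !andbT.
  move=> /and3P[/and3P[Nax Nay Naf] /andP[Nxy Nxf] Nyf].
  case: hx hy => [xu|ux] [yu|uy].
  - by move: Nxy; rewrite xu yu eqxx.
  - by apply: (near_no_path3 (a := a) (n := x) (m := y) (f := f)) => //; rewrite xu.
  - apply: (near_no_path3 (a := a) (n := y) (m := x) (f := f)) => //; rewrite ?yu //.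
    by rewrite -yu /= !inE !negb_or (eq_sym y x) Nax Nay Naf Nxy Nxf Nyf.
  - apply: (near_no3 (u := u) (x1 := a) (x2 := x) (x3 := y)) => //.
      by split; apply: inY.
    by rewrite (se u a).
have [ub ubY [aub hb]] := mid b bZ Nab.
have [uc ucY [auc hc]] := mid c cZ Nac.
have [ud udY [aud hd]] := mid d dZ Nad.
have [E|Nbc'] := eqVneq ub uc.
  rewrite -E in hc; apply: (same ub b c d) => //.
  by rewrite /= !inE !negb_or Nab Nac Nad Nbc Nbd Ncd.
have [E|Nbd'] := eqVneq ub ud.
  rewrite -E in hd; apply: (same ub b d c) => //.
  by rewrite /= !inE !negb_or (eq_sym d c) Nab Nac Nad Nbc Nbd Ncd.
have [E|Ncd'] := eqVneq uc ud.
  rewrite -E in hd; apply: (same uc c d b) => //.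
  by rewrite /= !inE !negb_or (eq_sym c b) (eq_sym d b) Nab Nac Nad Nbc Nbd Ncd.
by apply: (near_no3 (u := a) (x1 := ub) (x2 := uc) (x3 := ud)) => //; apply: inY.
Qed.
End Near.

(** Middle vertices outside [Y] are contracted away and those in [Y] stay, so that [Z] satisfies the
    hypotheses of [near_card]. *)
Lemma same_type_class_le3 e (Z : {set T}) : drawable e -> poles e -> 5 < #|Y| ->
  Z \subset Y ->
  (forall x y, x \in Z -> y \in Z -> x != y ->
     e x y \/ exists2 u, (u != w) && (u != z) & e u x && e u y) -> #|Z| <= 3.
Proof.
move=> De P Y5 ZY H.
pose S := [set s | [&& s \notin Y, s != w & s != z]].
have [|e' [De' P' H']] := contract_helpers (S := S) De P; first by move=> s; rewrite inE.
apply: (near_card De' P' Y5 ZY) => x y xZ yZ xy.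
have [xY yY] : x \in Y /\ y \in Y by split; apply: (subsetP ZY).
have [exy|[u /andP[uw uz] /andP[ux uy]]] := H x y xZ yZ xy.
  by left; apply: H' => //; left.
have [uY|uY] := boolP (u \in Y); last first.
  by left; apply: H' => //; right; exists u; rewrite ?inE ?uY ?uw ?uz ?ux.
right; exists u => //; apply/andP; split; apply: H' => //; last by left.
- by rewrite eq_sym (drawable_neq De ux).
- by left; rewrite (drawable_sym De).
- exact: (drawable_neq De uy).
Qed.
End TwoPoles.

(** * Counting pairs by contracting helpers *)

Lemma narcs_le_weak (T : finType) (e : rel T) (A : {set T}) :
  drawable e -> narcs e A <= 6 * #|A|.
Proof.
move=> De; have [A3|A3] := leqP #|A| 2; last by have := narcs_le De A3; lia.
rewrite -sum_const_in; apply: leq_sum => v vA.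
by apply: leq_trans (subset_leq_card (nbr_sub e A v)) _; lia.
Qed.

Section PairCount.
(** The pairs of [X] are counted; [S0] holds the helpers, [P z x y] says that [z] serves the pair
    xy, [K] is the price paid per arc, and [G] is a property kept by the contractions. *)
Variables (T : finType) (X S0 : {set T}) (P : T -> rel T) (Lam K Bd : nat).
Variable G : rel T -> Prop.
Hypothesis SX : forall s, s \in S0 -> s \notin X.
Hypothesis GD : forall e, G e -> drawable e.
Hypothesis GC : forall e s a, G e -> s \in S0 -> a \in X -> e s a -> G (contract e s a).
Hypothesis GB : forall e, G e -> narcs e X <= Bd.
Hypothesis Pirr : forall z x y, P z x y -> x != y.
Hypothesis PL : forall z x, x \in X -> #|[set y in X | P z x y]| <= Lam.
Hypothesis HK : forall d g, 0 < g -> d <= g + 4 -> d.-1 * minn Lam d.-2 <= 2 * g * K.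

Definition cov (e : rel T) (S : {set T}) : rel T :=
  fun x y => e x y || [exists z in S, P z x y].

(** For d >= 5 the set [N] with [s] spans at most 6(d + 1) - 12 arcs, 2d of them at [s]; so some [a]
    has at most three neighbours in [N] and gains at least d - 4. For d <= 4 any [a] with a
    non-neighbour in [N] will do. *)
Lemma contraction_gain (e : rel T) s : drawable e -> s \notin X ->
  ~~ [forall x in nbr e X s, forall y in nbr e X s, (x != y) ==> e x y] ->
  exists2 a, a \in nbr e X s &
    let g := #|[set y in X | [&& e s y, y != a & ~~ e a y]]| in
    0 < g /\ #|nbr e X s| <= g + 4.
Proof.
move=> De sX; set N := nbr e X s; set d := #|N| => ncl.
have se := drawable_sym De; have ie := drawable_irr De.
have gE a : a \in N ->
    d = (#|nbr e N a| + #|[set y in X | [&& e s y, y != a & ~~ e a y]]|).+1.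
  move=> aN; rewrite /d (cardsD1 a) aN add1n; congr _.+1.
  rewrite -(cardsID (nbr e N a)); congr (_ + _); apply: eq_card => y; rewrite !inE.
    case: (eqVneq y a) => [->|_] /=; first by rewrite ie !andbF.
    by case: (y \in X); case: (e s y).
  by case: (y \in X); case: (e s y); case: (y == a); case: (e a y).
have [d5|d4] := leqP 5 d; last first.
  move: ncl; rewrite negb_forall => /existsP[a]; rewrite negb_imply => /andP[aN].
  rewrite negb_forall => /existsP[y]; rewrite negb_imply negb_imply => /and3P[yN ay eay].
  exists a => //=; split; last by lia.
  apply/card_gt0P; exists y; move: yN; rewrite !inE => /andP[-> ->].
  by rewrite eq_sym ay.
have [a aN da] : exists2 a, a \in N & #|nbr e N a| < 4.
  apply: exists_le_average; rewrite -/(narcs e N).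
  have sN : s \notin N by rewrite in_nbr ie andbF.
  have cB : #|s |: N| = d.+1 by rewrite cardsU1 sN.
  have := narcs_D1 se ie (setU11 s N); rewrite setU1K // => E.
  have : narcs e (s |: N) + 12 <= 6 * #|s |: N| by apply: narcs_le => //; lia.
  have : d <= #|nbr e (s |: N) s|.
    apply/subset_leq_card/subsetP=> x xN; rewrite in_nbr inE xN orbT.
    by move: xN; rewrite in_nbr => /andP[].
  by rewrite cB; lia.
by exists a => //=; have := gE a aN; lia.
Qed.

(* Invariant of the contraction process: a helper of degree d whose contraction adds g
   edges serves at most [d.-1 * minn Lam d.-2] ordered pairs that do not become edges,
   and [HK] says that K times the number of new arcs pays for them. *)
Lemma cov_count (S : {set T}) (e : rel T) : S \subset S0 -> G e ->
  (forall s x y, s \in S -> x \in X -> y \in X -> P s x y -> e s x && e s y) ->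
  narcs (cov e S) X + K * narcs e X <= K.+1 * Bd.
Proof.
have [n] := ubnP #|S|; elim: n S e => // n IH S e ltS SS0 Ge HP.
have De := GD Ge.
have [S_0|[s sS]] := set_0Vmem S.
  rewrite mulSn; apply: leq_add; last by rewrite leq_mul // GB.
  apply: leq_trans (GB Ge); apply: leq_sum => x _; apply/subset_leq_card/subsetP=> y.
  rewrite !in_nbr /cov => /andP[-> /orP[-> //|/existsP[z]]].
  by rewrite S_0 inE.
have lt' : #|S :\ s| < n by have := cardsD1 s S; rewrite sS; lia.
have sub' : S :\ s \subset S0 by apply: subset_trans SS0; apply: subsetDl.
have sS0 : s \in S0 by apply: (subsetP SS0).
have sX := SX sS0.
have [/forall_inP cl|ncl] := boolP
   [forall x in nbr e X s, forall y in nbr e X s, (x != y) ==> e x y].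
  (* The pairs served by [s] are edges already, so [s] is dropped without contraction. *)
  apply: leq_trans (IH _ _ lt' sub' Ge _); last first.
    by move=> t x y; rewrite inE => /andP[_]; apply: HP.
  rewrite leq_add2r; apply: leq_sum => x xX; apply/subset_leq_card/subsetP=> y.
  rewrite !in_nbr /cov => /andP[yX]; rewrite yX /= => /orP[-> //|/exists_inP[z zS Pz]].
  have [zs|zs] := eqVneq z s; last first.
    by apply/orP; right; apply/exists_inP; exists z; rewrite ?inE ?zs.
  rewrite zs in Pz; have /andP[sx sy] := HP _ _ _ sS xX yX Pz.
  have xN : x \in nbr e X s by rewrite in_nbr xX.
  have yN : y \in nbr e X s by rewrite in_nbr yX.
  by have := forall_inP (cl x xN) y yN; rewrite (Pirr Pz) /= => ->.
have [a aN [g0 dg]] := contraction_gain De sX ncl.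
set g := #|_| in g0 dg.
have /andP[aX sa] : (a \in X) && e s a by rewrite -in_nbr.
have G1 := GC Ge sS0 aX sa; set e1 := contract e s a in G1.
have gain : narcs e X + 2 * g <= narcs e1 X := narcs_contract_gain De aX sX sa.
have nX x : x \in X -> x != s by apply: contraTneq => ->.
have sub x y : x != s -> y != s -> e x y -> e1 x y.
  by move=> xs ys xy; rewrite /e1 /contract xs ys xy (drawable_neq De xy).
have := IH _ _ lt' sub' G1; set I := narcs (cov e1 _) X => IH1.
have {}IH1 : I + K * narcs e1 X <= K.+1 * Bd.
  apply: IH1 => t x y; rewrite inE => /andP[ts tS] xX yX Pt.
  have /andP[tx ty] := HP _ _ _ tS xX yX Pt.
  by rewrite inE in ts; apply/andP; split; apply: sub => //; apply: nX.
set N := nbr e X s in aN dg.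
(* Pairs through [s] that contain [a] become edges. Only pairs inside [N] without [a] are charged,
   and at [x] the other end is one of |N| - 2 vertices. *)
pose c x := if x \in N :\ a then minn Lam #|N|.-2 else 0.
have cost : narcs (cov e S) X <= I + \sum_(x in X) c x.
  rewrite /I /narcs -big_split /=; apply: leq_sum => x xX.
  pose Q := [set y in X | [&& P s x y, x \in N :\ a & y \in N :\ a]].
  apply: (@leq_trans #|nbr (cov e1 (S :\ s)) X x :|: Q|).
    apply/subset_leq_card/subsetP=> y; rewrite in_setU !in_nbr => /andP[yX].
    rewrite yX /= => /orP[xy|/exists_inP[z zS Pz]].
      by rewrite /cov sub ?nX.
    have [zs|zs] := eqVneq z s; last first.
      apply/orP; left; apply/orP; right; apply/exists_inP; exists z => //.
      by rewrite !inE zs.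
    rewrite zs in Pz; have /andP[sx sy] := HP _ _ _ sS xX yX Pz.
    have xy := Pirr Pz.
    rewrite !inE yX Pz xX sx sy /= !andbT /cov /e1 /contract !nX // xy sx sy /=.
    by rewrite !andbT; case: (x == a); case: (y == a); rewrite /= ?orbT.
  apply: leq_trans (leq_card_setU _ _).1 _; rewrite leq_add2l /c.
  case: ifP => xN; last first.
    by rewrite leqn0 cards_eq0; apply/eqP/setP=> y; rewrite !inE in xN *; rewrite xN !andbF.
  rewrite leq_min; apply/andP; split.
    apply: leq_trans (PL s xX); apply/subset_leq_card/subsetP=> y.
    by rewrite !inE => /and3P[-> ->].
  have -> : #|N|.-2 = #|N :\ a :\ x|.
    by have := cardsD1 x (N :\ a); have := cardsD1 a N; rewrite aN xN; lia.
  apply/subset_leq_card/subsetP=> y; rewrite inE => /and4P[_ /Pirr xy _ yN].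
  by rewrite in_setD1 yN eq_sym xy.
have c_sum : \sum_(x in X) c x <= 2 * g * K.
  apply: leq_trans (HK g0 dg); rewrite /c -big_mkcondr /=.
  have -> : #|N|.-1 = #|N :\ a| by have := cardsD1 a N; rewrite aN; lia.
  rewrite -sum_nat_const; apply: eq_leq; apply: eq_bigl => x.
  by apply/andP/idP => [[]//|xN]; split=> //; move: xN; rewrite !inE => /and3P[].
apply: leq_trans IH1; apply: leq_trans (leq_add cost (leqnn _)) _.
rewrite -addnA leq_add2l; apply: leq_trans (leq_add c_sum (leqnn _)) _.
by rewrite mulnC -mulnDr addnC leq_mul.
Qed.

(** The invariant of [cov_count] leaves [K] unspent on each original arc in [X]; this pays for the
    pairs whose middle vertex is in [X]. *)
Lemma pair_count (e : rel T) : G e ->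
  (forall s x y, s \in S0 -> x \in X -> y \in X -> P s x y -> e s x && e s y) ->
  (forall x y, x \in X -> y \in X -> x != y ->
     e x y \/ exists2 z, z \in S0 :|: X & P z x y) ->
  \sum_(z in X) \sum_(x in X) #|[set y in X | P z x y]| <= K * narcs e X ->
  #|X| * #|X|.-1 <= K.+1 * Bd.
Proof.
move=> Ge HP H M; apply: leq_trans (cov_count (subxx _) Ge HP).
apply: leq_trans (leq_add (leqnn _) M).
rewrite exchange_big -big_split /= -sum_nat_const; apply: leq_sum => x xX.
have -> : #|X|.-1 = #|X :\ x| by have := cardsD1 x X; rewrite xX; lia.
apply: (@leq_trans #|nbr (cov e S0) X x :|: \bigcup_(z in X) [set y in X | P z x y]|).
  apply/subset_leq_card/subsetP=> y; rewrite in_setU in_nbr !inE => /andP[yx yX].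
  have xy : x != y by rewrite eq_sym.
  rewrite yX /= /cov; have [-> //|[z]] := H x y xX yX xy.
  rewrite inE => /orP[zS|zX] Pz.
    by apply/orP; left; apply/orP; right; apply/exists_inP; exists z.
  by apply/orP; right; apply/bigcupP; exists z; rewrite // inE yX.
apply: leq_trans (leq_card_setU _ _).1 _; rewrite leq_add2l.
elim/big_rec2: _ => [|z m A zX le]; first by rewrite cards0.
by apply: leq_trans (leq_card_setU _ _).1 _; rewrite leq_add2l.
Qed.
End PairCount.

(** * Cliques in drawable graphs *)

Lemma card_other_classes (T C : finType) (A : {set T}) (f : T -> C) (c0 : C) (b : nat) :
  (forall c, c != c0 -> #|[set y in A | f y == c]| <= b) ->
  #|[set y in A | f y != c0]| <= #|C|.-1 * b.
Proof.
move=> H; rewrite -sum1dep_card (partition_big f (fun c => c != c0)) /=; last first.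
  by move=> i /andP[].
have -> : #|C|.-1 = #|predC1 c0| by have := cardC1 c0; lia.
rewrite -sum_nat_const; apply: leq_sum => c cc0.
rewrite sum1dep_card; apply: leq_trans (H c cc0).
by apply/subset_leq_card/subsetP=> y; rewrite !inE => /andP[/andP[-> _] ->].
Qed.

Section UpperBound.
Variables (T C : finType) (e : rel T) (col : T -> T -> C) (R : {set T}).
Hypothesis De : drawable e.
Hypothesis sees : forall x y, x \in R -> y \in R -> x != y ->
  e x y \/ exists z, [&& e z x, e z y & col z x != col z y].
Hypothesis p2 : 1 < #|C|.

Let p := #|C|.
Let via z x y := [&& e z x, e z y & col z x != col z y].

Lemma via_neq z x y : via z x y -> x != y.
Proof. by case/and3P => _ _; apply: contraNneq => ->. Qed.

Lemma sum_via_le (X : {set T}) (P : T -> rel T) (Lam : nat) z :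
  (forall x, x \in X -> #|[set y in X | P z x y]| <= Lam) ->
  (forall x y, P z x y -> e z x) ->
  \sum_(x in X) #|[set y in X | P z x y]| <= Lam * #|nbr e X z|.
Proof.
move=> PL Pe; rewrite -sum_const_in.
rewrite [X in _ <= X](eq_bigl (fun x => (x \in X) && e z x)); last by move=> x; rewrite in_nbr.
rewrite big_mkcondr /=; apply: leq_sum => x xX; case: ifPn => ex; first exact: PL.
rewrite leqn0 cards_eq0; apply/eqP/setP=> y; rewrite !inE.
by apply/negP => /andP[_ /Pe]; apply/negP.
Qed.

(** From d = 7 on, d - 1 <= 2(d - 4) <= 2g; below, the factor d - 2 and [K] >= 6 suffice. *)
Lemma cost_le_gain_small (Lam K d g : nat) : Lam <= K -> 5 < K -> 0 < g -> d <= g + 4 ->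
  d.-1 * minn Lam d.-2 <= 2 * g * K.
Proof.
move=> LK K5 g0 dg; have [d5|d6] := leqP d 5.
  apply: (@leq_trans (4 * 3)); last by apply: (@leq_trans (2 * 1 * 6)); rewrite // !leq_mul.
  by apply: leq_mul; first lia; apply: leq_trans (geq_minr _ _) _; lia.
have [d7|d8] := leqP d 6.
  have -> : d = 6 by lia.
  apply: (@leq_trans (5 * 4)); first by rewrite leq_mul // geq_minr.
  by apply: (@leq_trans (2 * 2 * 6)); rewrite // !leq_mul //; lia.
by apply: leq_mul; [lia | apply: leq_trans (geq_minl _ _) LK].
Qed.

(** For 5 <= d <= 40, (d - 1)(d - 2) <= 46(d - 4), and [K] >= 23; from d = 25 on, 7(d - 1) <= 8(d -
    4), so 4/7 of [Lam] is enough. *)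
Lemma cost_le_gain_large (Lam K d g : nat) : 4 * Lam + 161 <= 7 * K -> 0 < g -> d <= g + 4 ->
  d.-1 * minn Lam d.-2 <= 2 * g * K.
Proof.
move=> LK g0 dg; have [d5|d6] := leqP d 5.
  apply: (@leq_trans (4 * 3)); last by apply: (@leq_trans (2 * 1 * 6)); rewrite // !leq_mul //; lia.
  by apply: leq_mul; first lia; apply: leq_trans (geq_minr _ _) _; lia.
have [n dE] : exists n, d = n + 6 by exists (d - 6); lia.
have [d7|d8] := leqP d 40.
  apply: (@leq_trans (d.-1 * d.-2)); first by rewrite leq_mul // geq_minr.
  apply: (@leq_trans (2 * (n + 2) * 23)); last by rewrite !leq_mul //; lia.
  by rewrite dE !addnS addn0 /=; nia.
apply: (@leq_trans (d.-1 * Lam)); first by rewrite leq_mul // geq_minl.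
apply: (@leq_trans (2 * (n + 2) * K)); last by rewrite !leq_mul //; lia.
rewrite dE !addnS addn0 /=; nia.
Qed.

Definition typed_nbr (w : T) (c : C) := [set x in R | e w x && (col w x == c)].

(** Three vertices for each of p - 1 other types; the 6 covers the case of at most five common
    neighbours and the condition of [cost_le_gain_small]. *)
Let K1 := maxn 6 (3 * p - 3).

(** A special 2-path between vertices with equal types to [w] and equal types to [z] avoids both, so
    [same_type_class_le3] bounds each class by three. *)
Lemma via_apex_le w c z x : z != w -> x \in typed_nbr w c ->
  #|[set y in typed_nbr w c | via z x y]| <= K1.
Proof.
move=> zw xX; set X := typed_nbr w c in xX *; set Y := nbr e X z.
have wz : w != z by rewrite eq_sym.
have [zx|zx] := boolP (e z x); last first.
  rewrite (_ : [set _ in _ | _] = set0) ?cards0 //; apply/setP=> y.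
  by rewrite !inE /via (negPf zx) andbF.
have [Y5|Y6] := leqP #|Y| 5.
  apply: (@leq_trans #|Y|); last by rewrite /K1; lia.
  apply/subset_leq_card/subsetP=> y; rewrite inE => /and4P[yX _ zy _].
  by rewrite in_nbr yX.
apply: (@leq_trans #|[set y in Y | col z y != col z x]|).
  apply/subset_leq_card/subsetP=> y; rewrite inE => /and4P[yX _ zy cc].
  by rewrite inE in_nbr yX zy eq_sym.
apply: (@leq_trans (p.-1 * 3)); last by rewrite /K1; lia.
apply: card_other_classes => c' _.
have P : poles w z Y e.
  by move=> y; rewrite in_nbr !inE => /andP[/and3P[_ -> _] ->].
apply: (same_type_class_le3 wz De P Y6).
  by apply/subsetP=> y; rewrite inE => /andP[].
move=> u v; rewrite !inE => /andP[/andP[/and3P[uR wu /eqP cu] zu] /eqP cu'].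
move=> /andP[/andP[/and3P[vR wv /eqP cv] zv] /eqP cv'] uv.
have [|[t /and3P[tu tv ct]]] := sees uR vR uv; first by left.
right; exists t; last by rewrite tu.
apply/andP; split.
  by apply: contraNneq ct => ->; rewrite cu cv.
by apply: contraNneq ct => ->; rewrite cu' cv'.
Qed.

(** No pair in the class is served by [w], which is never contracted and remains an apex over [X]:
    of at most 6|X| - 6 arcs, 2|X| are at [w], leaving 4|X| - 6. *)
Lemma typed_nbr_le w c : #|typed_nbr w c| <= 4 * K1.+1.
Proof.
set X := typed_nbr w c; have [k2|k2] := leqP #|X| 2; first by lia.
have wX : w \notin X by rewrite inE drawable_irr // andbF.
pose P z x y := (z != w) && via z x y.
pose G e' := drawable e' /\ forall x, x \in X -> e' w x.
suff h : #|X| * #|X|.-1 <= K1.+1 * (4 * #|X| - 6).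
  rewrite leqNgt; apply/negP => gt; move: h; apply/negP; rewrite -ltnNge.
  move: #|X| K1 k2 gt => k K k2 gt; nia.
have XP z x y : P z x y -> e z x && e z y by case/andP=> _ /and3P[-> ->].
apply: (@pair_count _ X (~: (w |: X)) P K1 K1 (4 * #|X| - 6) G) (e) _ _ _ _.
- by move=> s; rewrite in_setC in_setU1 negb_or => /andP[].
- by move=> e' [].
- move=> e' s a [D' H'] sS aX sa; split; first exact: drawable_contract.
  move=> x xX; have wx := H' x xX.
  have [ws xs] : w != s /\ x != s.
    move: sS; rewrite in_setC in_setU1 negb_or => /andP[sw sX].
    by rewrite [w == s]eq_sym; split=> //; apply: contraNneq sX => <-.
  by rewrite /contract ws xs wx (drawable_neq D' wx).
- move=> e' [D' H'].
  have := narcs_D1 (drawable_sym D') (drawable_irr D') (setU11 w X).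
  rewrite setU1K // => E.
  have cX : #|w |: X| = #|X|.+1 by rewrite cardsU1 wX.
  have : narcs e' (w |: X) + 12 <= 6 * #|w |: X| by apply: narcs_le => //; rewrite cX; lia.
  have : #|X| <= #|nbr e' (w |: X) w|.
    by apply/subset_leq_card/subsetP=> x xX; rewrite in_nbr inE xX orbT H'.
  by rewrite cX E; lia.
- by move=> z x y /andP[_ /via_neq].
- move=> z x xX; have [zw|zw] := eqVneq z w.
    rewrite (_ : [set _ in _ | _] = set0) ?cards0 //; apply/setP=> y.
    by rewrite !inE /P zw eqxx !andbF.
  apply: leq_trans (via_apex_le zw xX); apply/subset_leq_card/subsetP=> y.
  by rewrite !inE /P => /andP[-> /andP[_ ->]].
- by move=> d g g0 dg; apply: cost_le_gain_small => //; rewrite /K1; lia.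
- by split=> // x; rewrite inE => /and3P[].
- by move=> s x y _ _ _; apply: XP.
- move=> x y; rewrite !inE => /and3P[xR wx /eqP cx] /and3P[yR wy /eqP cy] xy.
  have [|[z v]] := sees xR yR xy; first by left.
  have zw : z != w.
    by case/and3P: v => _ _; apply: contraNneq => ->; rewrite cx cy.
  by right; exists z; rewrite /P ?zw //; rewrite !in_setU in_setC in_setU1 (negPf zw) orNb.
rewrite /narcs big_distrr /=; apply: leq_sum => z zX; apply: sum_via_le.
  move=> x xX; have zw : z != w by apply: contraTneq zX => ->.
  apply: leq_trans (via_apex_le zw xX); apply/subset_leq_card/subsetP=> y.
  by rewrite !inE /P => /andP[-> /andP[_ ->]].
by move=> x y /XP/andP[].
Qed.

Let Lam := p.-1 * (4 * K1.+1).

Lemma via_le z x : x \in R -> #|[set y in R | via z x y]| <= Lam.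
Proof.
move=> xR; apply: (@leq_trans #|[set y in nbr e R z | col z y != col z x]|).
  apply/subset_leq_card/subsetP=> y; rewrite !inE => /and4P[-> _ -> cc].
  by rewrite eq_sym.
apply: card_other_classes => c _; apply: leq_trans (typed_nbr_le z c).
by apply/subset_leq_card/subsetP=> y; rewrite !inE -andbA.
Qed.

Lemma clique_le (K : nat) :
  (forall d g, 0 < g -> d <= g + 4 -> d.-1 * minn Lam d.-2 <= 2 * g * K) ->
  \sum_(z in R) \sum_(x in R) #|[set y in R | via z x y]| <= K * narcs e R ->
  #|R| <= 6 * K.+1.
Proof.
move=> HK M; have [k2|k2] := leqP #|R| 2; first by lia.
suff h : #|R| * #|R|.-1 <= K.+1 * (6 * #|R| - 12).
  rewrite leqNgt; apply/negP => gt; move: h; apply/negP; rewrite -ltnNge.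
  move: #|R| K k2 gt {M HK} => k K k2 gt; nia.
apply: (@pair_count _ R (~: R) via Lam K (6 * #|R| - 12) (@drawable T)) (e) _ _ _ _ => //.
- by move=> s; rewrite inE.
- by move=> e' s a D' _ _ sa; apply: drawable_contract.
- by move=> e' D'; have := narcs_le D' k2; lia.
- exact: via_neq.
- by move=> z x; apply: via_le.
- by move=> s x y _ _ _ /and3P[-> ->].
move=> x y xR yR xy; have [|[z v]] := sees xR yR xy; first by left.
by right; exists z; rewrite // setUC setUCr.
Qed.

(** An edge leaving [W] is counted once by the degrees of [W] but twice in [narcs e R]; an edge
    inside [W] is counted twice by both. *)
Lemma hub_degree_sum (W : {set T}) : W \subset R ->
  2 * \sum_(z in W) #|nbr e R z| <= narcs e R + narcs e W.
Proof.
move=> WR; have se := drawable_sym De.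
have split z : #|nbr e R z| = #|nbr e W z| + #|nbr e (R :\: W) z|.
  rewrite -(cardsID W (nbr e R z)); congr (_ + _); apply: eq_card => y; rewrite !inE.
    by case: (boolP (y \in W)) => [/(subsetP WR) ->|_]; rewrite ?andbF ?andbT.
  by rewrite andbA.
have RE : narcs e R = \sum_(z in W) #|nbr e R z| + \sum_(z in R :\: W) #|nbr e R z|.
  rewrite /narcs (big_setID W) /=; congr (_ + _); apply: eq_bigl => z.
  by rewrite inE; case: (boolP (z \in W)) => [/(subsetP WR) ->|_]; rewrite ?andbF.
have dc (A B : {set T}) : \sum_(z in A) #|nbr e B z| = \sum_(z in B) #|nbr e A z|.
  have cE (D : {set T}) z : #|nbr e D z| = \sum_(y in D) (e z y : nat).
    rewrite -big_mkcondr /= sum1dep_card; apply: eq_card => y.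
    by rewrite !inE.
  under eq_bigr do rewrite cE; rewrite exchange_big /=; apply: eq_bigr => z _.
  by rewrite cE; apply: eq_bigr => y _; rewrite se.
have : \sum_(z in R :\: W) #|nbr e W z| <= \sum_(z in R :\: W) #|nbr e R z|.
  by apply: leq_sum => z _; rewrite split leq_addr.
rewrite dc => h.
have : \sum_(z in W) #|nbr e R z| = narcs e W + \sum_(z in W) #|nbr e (R :\: W) z|.
  by rewrite /narcs -big_split /=; apply: eq_bigr => z _.
by rewrite RE; lia.
Qed.

(* Arcs at vertices of degree at least 24 are counted from one end only, up to the few
   arcs between two such vertices; this halves the main term. *)
Lemma via_sum_hubs (K : nat) : 4 * Lam + 161 <= 7 * K ->
  \sum_(z in R) \sum_(x in R) #|[set y in R | via z x y]| <= K * narcs e R.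
Proof.
move=> HK; pose W := [set z in R | 24 <= #|nbr e R z|].
have WR : W \subset R by apply/subsetP=> z; rewrite inE => /andP[].
set D := \sum_(z in W) #|nbr e R z|.
have D1 : 24 * #|W| <= D.
  by rewrite -sum_const_in; apply: leq_sum => z; rewrite inE => /andP[].
(* From 2D <= narcs e R + 6|W| and 24|W| <= D. *)
have D2 : 7 * D <= 4 * narcs e R.
  by have := hub_degree_sum WR; have := narcs_le_weak W De; rewrite -/D; lia.
(* Vertices outside [W] have degree at most 23, which replaces [Lam] for them; 161 = 7 * 23. *)
apply: (@leq_trans (Lam * D + 23 * narcs e R)); last by nia.
rewrite (big_setID W) /= (setIidPr WR); apply: leq_add.
  rewrite /D big_distrr /=; apply: leq_sum => z _; apply: sum_via_le.
    by move=> x; apply: via_le.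
  by move=> x y /and3P[].
rewrite /narcs big_distrr /= [X in _ <= X](big_setID W) /=.
apply: leq_trans (leq_addl _ _); apply: leq_sum => z; rewrite !inE => /andP[nW zR].
rewrite zR /= -ltnNge ltnS in nW.
apply: sum_via_le; last by move=> x y /and3P[].
move=> x _; apply: leq_trans nW; apply/subset_leq_card/subsetP=> y.
by rewrite !inE => /and4P[-> _ ->].
Qed.

Lemma clique_bound : #|R| <= 42 * p ^ 2 + 8.
Proof.
(* For p = 2 the price K = Lam = 28 gives 6 * 29 = 174, below 176. *)
have [p2'|p3] := leqP p 2.
  have pE : p = 2 by rewrite /p; lia.
  have LE : Lam = 28 by rewrite /Lam /K1 pE.
  apply: (@leq_trans (6 * Lam.+1)); last by rewrite LE pE.
  apply: clique_le.
    by move=> d g; apply: cost_le_gain_small; rewrite // LE.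
  rewrite /narcs big_distrr /=; apply: leq_sum => z _; apply: sum_via_le.
    by move=> x; apply: via_le.
  by move=> x y /and3P[].
have K1E : K1 = 3 * p - 3 by rewrite /K1; lia.
have LE : Lam = p.-1 * (12 * p - 8) by rewrite /Lam K1E; congr (_ * _); lia.
(* The least K with 7K >= 4 Lam + 161; the main term of 6K is 6 * 4/7 * 12 p^2, below 42 p^2. *)
pose K := (4 * Lam + 167) %/ 7.
have K7 : 4 * Lam + 161 <= 7 * K <= 4 * Lam + 167 by rewrite /K; lia.
case/andP: K7 => KL KU.
apply: (@leq_trans (6 * K.+1)).
  by apply: clique_le; [move=> d g; apply: cost_le_gain_large | apply: via_sum_hubs].
move: KU p3; rewrite LE -mulnn; move: (K) (p) => k q KU q3.
have [r rE] : exists r, q = r + 3 by exists (q - 3); lia.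
rewrite {}rE in KU *; nia.
Qed.
End UpperBound.

(** * Planar graphs are drawable *)

Delimit Scope R_scope with RR.

Definition Rltb (x y : R) : bool := if Rlt_dec x y then true else false.

Lemma RltbP x y : reflect (x < y)%RR (Rltb x y).
Proof. by rewrite /Rltb; case: Rlt_dec => h; constructor. Qed.

Definition psub (a b : R * R) : R * R := (a.1 - b.1, a.2 - b.2)%RR.

(** These half-planes cover the punctured plane, and a closed polygon inside one of them does not
    wind around the origin. *)
Definition halfplane (d : bool * bool) (z : R * R) : Prop :=
  match d with
  | (true, true) => (0 < z.1)%RR
  | (true, false) => (z.1 < 0)%RR
  | (false, true) => (0 < z.2)%RR
  | (false, false) => (z.2 < 0)%RR
  end.

(* Crossing parity of a short step with the negative x-axis. *)
Definition cut (z z' : R * R) : bool :=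
  Rltb z.1 0 && (Rltb z.2 0 (+) Rltb z'.2 0).

(** The open upper half-plane with the negative half-axis: the sign of z in a lexicographic order,
    sided to match [cut]. *)
Definition upper (z : R * R) : bool :=
  Rltb 0 z.2 || ~~ Rltb z.2 0 && Rltb z.1 0.

Ltac rltb := repeat match goal with
  | |- context [Rltb ?x ?y] => case: (RltbP x y) => ? //=
  end.

(** Within one half-plane [cut] either vanishes or is the change of a sign along the step, so it
    sums to zero around the cell. *)
Lemma cut_cell d p q r s : halfplane d p -> halfplane d q -> halfplane d r ->
  halfplane d s -> cut p q (+) cut q r (+) (cut s r (+) cut p s) = false.
Proof.
rewrite /cut; case: d => [[] []] /= hp hq hr hs; rltb; exfalso; lra.
Qed.

(** Crossings of the negative half-axis by z and by -z together make up all crossings of the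
    horizontal axis by z. *)
Lemma cut_opp d a b c : halfplane d (psub a c) -> halfplane d (psub b c) ->
  cut (psub a c) (psub b c) (+) cut (psub c a) (psub c b)
  = upper (psub a c) (+) upper (psub b c).
Proof.
rewrite /cut /upper /psub; case: d => [[] []] /= ha hb; rltb; exfalso; lra.
Qed.

Lemma upper_opp a b : a <> b -> upper (psub b a) = ~~ upper (psub a b).
Proof.
case: a b => [a1 a2] [b1 b2] ab; rewrite /upper /psub /=; rltb; exfalso; try lra.
all: by apply: ab; congr (_, _); lra.
Qed.

(** In the sum over all cells every inner grid edge occurs twice and cancels. *)
Lemma grid_boundary (h v : nat -> nat -> bool) (N M : nat) :
  (forall i j, i < N -> j < M ->
     h i j (+) v i.+1 j (+) (h i j.+1 (+) v i j) = false) ->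
  \big[addb/false]_(i < N) h i 0 (+) \big[addb/false]_(i < N) h i M
  (+) (\big[addb/false]_(j < M) v 0 j (+) \big[addb/false]_(j < M) v N j) = false.
Proof.
move=> H.
have row j n : j < M -> n <= N ->
    \big[addb/false]_(i < n) h i j (+) \big[addb/false]_(i < n) h i j.+1
    = v 0 j (+) v n j.
  move=> jM; elim: n => [|n IH] nN; first by rewrite !big_ord0 !addbb.
  rewrite !big_ord_recr /=; move: (IH (ltnW nN)) (H n j nN jM).
  move: (\big[_/_]_(i < n) h i j) (\big[_/_]_(i < n) h i j.+1) => b b'.
  by case: b; case: b'; case: (v 0 j); case: (v n j); case: (h n j);
    case: (h n j.+1); case: (v n.+1 j).
elim: M H row => [|M IH] H row; first by rewrite !big_ord0 !addbb.
rewrite !big_ord_recr /=.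
have := row M N (ltnSn M) (leqnn N).
have := IH (fun i j iN jM => H i j iN (ltnW jM)) (fun j n jM => row j n (ltnW jM)).
move: (\big[_/_]_(i < N) h i 0) (\big[_/_]_(i < N) h i M)
  (\big[_/_]_(i < N) h i M.+1) (\big[_/_]_(i < M) v 0 i) (\big[_/_]_(i < M) v N i).
by do 5 case; case: (v 0 M); case: (v N M).
Qed.

Lemma big_addb_telescope (f : nat -> bool) n :
  \big[addb/false]_(i < n) (f i (+) f i.+1) = f 0 (+) f n.
Proof.
elim: n => [|n IH]; first by rewrite big_ord0 !addbb.
by rewrite big_ord_recr /= IH; case: (f 0); case: (f n); case: (f n.+1).
Qed.

Definition sample (g : R -> R * R) (N i : nat) : R * R := g (INR i / INR N)%RR.

Definition winding (N : nat) (g : R -> R * R) (w : R * R) : bool :=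
  \big[addb/false]_(i < N) cut (psub (sample g N i) w) (psub (sample g N i.+1) w).

(** Discrete form of the condition that g(s) - h(t) maps the unit square to the punctured plane. *)
Definition fine_mesh (N : nat) (g h : R -> R * R) : Prop :=
  forall i j, i < N -> j < N -> exists d,
    forall i' j', i <= i' <= i.+1 -> j <= j' <= j.+1 ->
      halfplane d (psub (sample g N i') (sample h N j')).

(** This is [grid_boundary] for g(s) - h(t). Two sides of the square give the winding of [g] about
    the ends of [h]; the other two see [h] with opposite sign, which [cut_opp] trades for the
    [upper] terms. *)
Lemma winding_boundary N g h : 0 < N -> fine_mesh N g h ->
  winding N g (h R0) (+) winding N g (h R1) (+)
    (winding N h (g R0) (+) winding N h (g R1))
  = upper (psub (h R0) (g R0)) (+) upper (psub (h R1) (g R0)) (+)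
    (upper (psub (h R0) (g R1)) (+) upper (psub (h R1) (g R1))).
Proof.
move=> N0 mesh.
have NR : (INR N <> 0)%RR by apply: not_0_INR; lia.
have s0 f : sample f N 0 = f R0 by rewrite /sample /Rdiv /= Rmult_0_l.
have sN f : sample f N N = f R1 by rewrite /sample /Rdiv Rinv_r.
pose F i j := psub (sample g N i) (sample h N j).
have := @grid_boundary (fun i j => cut (F i j) (F i.+1 j))
   (fun i j => cut (F i j) (F i j.+1)) N N.
have cell i j : i < N -> j < N ->
   cut (F i j) (F i.+1 j) (+) cut (F i.+1 j) (F i.+1 j.+1)
   (+) (cut (F i j.+1) (F i.+1 j.+1) (+) cut (F i j) (F i j.+1)) = false.
  move=> iN jN; have [d H] := mesh i j iN jN.
  by apply: (@cut_cell d); apply: H; rewrite ?leqnn ?leqnSn.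
move=> /(_ cell).
have side i i0 : i0 < N -> i0 <= i <= i0.+1 ->
    \big[addb/false]_(j < N) cut (F i j) (F i j.+1) =
    winding N h (sample g N i) (+)
    (upper (psub (h R0) (sample g N i)) (+) upper (psub (h R1) (sample g N i))).
  move=> i0N ii0; rewrite -(sN h) -{1}(s0 h).
  rewrite -(big_addb_telescope (fun j => upper (psub (sample h N j) (sample g N i)))).
  rewrite /winding -big_split /=; apply: eq_bigr => j _.
  have [d H] := mesh i0 j i0N (ltn_ord j).
  have [H1 H2] : halfplane d (F i j) /\ halfplane d (F i j.+1).
    by split; apply: H; rewrite // ?leqnn ?leqnSn.
  have [d' [G1 G2]] : exists d', halfplane d' (psub (sample h N j) (sample g N i)) /\
      halfplane d' (psub (sample h N j.+1) (sample g N i)).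
    exists (d.1, ~~ d.2); move: H1 H2; rewrite /F /psub.
    by case: d {H} => [[] []] /=; split; lra.
  by rewrite -(cut_opp G1 G2) addbA addbb.
rewrite (side 0 0) // (side N N.-1) ?s0 ?sN //; [|lia|lia].
rewrite /F -/(winding N g (sample h N 0)) -/(winding N g (sample h N N)) s0 sN.
by do 4 case: (winding _ _ _); do 4 case: (upper _).
Qed.

(** The difference is continuous and non-zero on a compact square; a Lebesgue number of the local
    half-planes bounds the mesh width. *)
Lemma fine_mesh_eventually (g h : R -> R * R) : cont01 g -> cont01 h ->
  (forall s t, in01 s -> in01 t -> g s <> h t) ->
  exists n0, forall N, n0 <= N -> fine_mesh N g h.
Proof.
move=> cg ch dis.
(* The factor 2 leaves room for a whole cell at a grid point within distance r of [q]. *)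
have loc (q : R * R) : exists r : posreal, in01 q.1 -> in01 q.2 -> exists d, forall s t,
    in01 s -> in01 t -> (Rabs (s - q.1) < 2 * r)%RR -> (Rabs (t - q.2) < 2 * r)%RR ->
    halfplane d (psub (g s) (h t)).
  case: q => u v /=; have [[u1 v1]|nuv] := classic (in01 u /\ in01 v); last first.
    by exists (mkposreal _ Rlt_0_1) => u1 v1; case: nuv.
  have uni (eps : R) : (0 < eps)%RR -> exists r : posreal, forall s t, in01 s -> in01 t ->
     (Rabs (s - u) < 2 * r)%RR -> (Rabs (t - v) < 2 * r)%RR ->
     (Rabs (fst (psub (g s) (h t)) - fst (psub (g u) (h v))) < 2 * eps)%RR /\
     (Rabs (snd (psub (g s) (h t)) - snd (psub (g u) (h v))) < 2 * eps)%RR.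
    move=> e0; have [dg [dg0 Hg]] := cg u u1 eps e0; have [dh [dh0 Hh]] := ch v v1 eps e0.
    have r0 : (0 < Rmin dg dh / 2)%RR.
      by have := Rmin_glb_lt _ _ _ dg0 dh0; lra.
    exists (mkposreal _ r0) => s t s1 t1 /= su tv.
    have [] := Hg s s1; first by have := Rmin_l dg dh; lra.
    have [] := Hh t t1; first by have := Rmin_r dg dh; lra.
    by rewrite /psub /=; split_Rabs; lra.
  have [c1|[c1|[c2|c2]]] : (0 < fst (psub (g u) (h v)) \/ fst (psub (g u) (h v)) < 0 \/
      0 < snd (psub (g u) (h v)) \/ snd (psub (g u) (h v)) < 0)%RR.
  - have := dis u v u1 v1; rewrite /psub; case: (g u) (h v) => [a1 a2] [b1 b2] /= ab.
    have [E1|?] := Req_dec a1 b1; last by lra.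
    have [E2|?] := Req_dec a2 b2; last by lra.
    by case: ab; rewrite E1 E2.
  - have [r Hr] := uni _ (Rmult_lt_0_compat _ _ c1 (Rinv_0_lt_compat 2 Rlt_0_2)).
    exists r => _ _; exists (true, true) => s t s1 t1 su tv.
    by have [+ _] := Hr s t s1 t1 su tv; move: c1; rewrite /=; split_Rabs; lra.
  - have c1' : (0 < - fst (psub (g u) (h v)))%RR by lra.
    have [r Hr] := uni _ (Rmult_lt_0_compat _ _ c1' (Rinv_0_lt_compat 2 Rlt_0_2)).
    exists r => _ _; exists (true, false) => s t s1 t1 su tv.
    by have [+ _] := Hr s t s1 t1 su tv; move: c1; rewrite /=; split_Rabs; lra.
  - have [r Hr] := uni _ (Rmult_lt_0_compat _ _ c2 (Rinv_0_lt_compat 2 Rlt_0_2)).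
    exists r => _ _; exists (false, true) => s t s1 t1 su tv.
    by have [_] := Hr s t s1 t1 su tv; move: c2; rewrite /=; split_Rabs; lra.
  - have c2' : (0 < - snd (psub (g u) (h v)))%RR by lra.
    have [r Hr] := uni _ (Rmult_lt_0_compat _ _ c2' (Rinv_0_lt_compat 2 Rlt_0_2)).
    exists r => _ _; exists (false, false) => s t s1 t1 su tv.
    by have [_] := Hr s t s1 t1 su tv; move: c2; rewrite /=; split_Rabs; lra.
pose delta (u v : R) : posreal :=
  proj1_sig (constructive_indefinite_description _ (loc (u, v))).
have deltaP u v := proj2_sig (constructive_indefinite_description _ (loc (u, v))).
have [d Hd] := Compactness.compactness_value_2d 0 1 0 1 delta.
have [n0 [n0d n0p]] := archimed_cor1 d (cond_pos d).
exists n0 => N nN i j iN jN.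
have Npos : (0 < INR N)%RR by apply: lt_0_INR; lia.
have n0pos : (0 < INR n0)%RR by apply: lt_0_INR; lia.
have invN : (/ INR N < d)%RR.
  apply: Rle_lt_trans n0d; apply: Rinv_le_contravar => //.
  by apply: le_INR; lia.
have in1 k : k <= N -> in01 (INR k / INR N)%RR.
  move=> kN; have k0 := pos_INR k.
  have kN' : (INR k <= INR N)%RR by apply: le_INR; lia.
  split; first by apply: Rmult_le_pos => //; apply/Rlt_le/Rinv_0_lt_compat.
  by apply: (Rmult_le_reg_r (INR N)) => //; rewrite /Rdiv Rmult_assoc Rinv_l; lra.
have [u [v [u1 [v1 [xu [yv dd]]]]]] := NNPP _ (Hd _ _ (in1 i (ltnW iN)) (in1 j (ltnW jN))).
have [c Hc] := deltaP u v u1 v1; exists c => i' j' ii jj.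
have near k k' x : k <= k' <= k.+1 -> (Rabs (INR k / INR N - x) < delta u v)%RR ->
    (Rabs (INR k' / INR N - x) < 2 * delta u v)%RR.
  move=> kk hk; have [->|->] : k' = k \/ k' = k.+1 by lia.
    by have := cond_pos (delta u v); lra.
  rewrite S_INR; have -> : ((INR k + 1) / INR N = INR k / INR N + / INR N)%RR by field; lra.
  by move: hk; have := Rinv_0_lt_compat _ Npos; split_Rabs; lra.
by apply: Hc; [apply: in1; lia | apply: in1; lia | apply: near ii xu | apply: near jj yv].
Qed.

Lemma planar_drawable (T : finType) (e : rel T) :
  simple_graph e -> planar e -> drawable e.
Proof.
move=> [ie se] [pos [arc [injp H]]]; split; [by move=> u; apply: negbTE | by [] |].
pose ok (q : T * T * (T * T)) N := let: (u, v, (w, x)) := q in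
  [&& e u v, e w x, u != w, u != x & (v != w) && (v != x)] ->
  fine_mesh N (arc u v) (arc w x).
have ev q : exists n0, forall N, n0 <= N -> ok q N.
  case: q => [[u v] [w x]]; rewrite /ok.
  have [/and5P[uv wx uw ux /andP[vw vx]]|_] := boolP [&& _, _, _, _ & _]; last by exists 0.
  have [cg [g0 [g1 [_ [gp gi]]]]] := H u v uv.
  have [ch [h0 [h1 [_ [hp _]]]]] := H w x wx.
  have [s t s1 t1 E|n0 Hn] := fine_mesh_eventually cg ch.
    have nd : ~ ((w = u /\ x = v) \/ (w = v /\ x = u)).
      by case=> [[E1 _]|[E1 _]]; [move: uw|move: vw]; rewrite E1 eqxx.
    have ends a : in01 a -> a = R0 \/ a = R1 \/ in01o a.
      move=> [a0 a1]; have [?|] := Req_dec a 0; first by left.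
      by have [?|] := Req_dec a 1; [right; left | right; right; split; lra].
    case: (ends s s1) => [s0|[s0|s0]]; case: (ends t t1) => [t0|[t0|t0]];
      rewrite ?s0 ?t0 ?g0 ?g1 ?h0 ?h1 in E.
    - by move: uw; rewrite (injp _ _ E) eqxx.
    - by move: ux; rewrite (injp _ _ E) eqxx.
    - by apply: (hp t u t0).
    - by move: vw; rewrite (injp _ _ E) eqxx.
    - by move: vx; rewrite (injp _ _ E) eqxx.
    - by apply: (hp t v t0).
    - by apply: (gp s w s0).
    - by apply: (gp s x s0).
    - by apply: (gi w x wx nd s t s0 t0).
  by exists n0 => N nN _; apply: Hn.
have [f Hf] : exists f : T * T * (T * T) -> nat, forall q N, f q <= N -> ok q N.
  exists (fun q => proj1_sig (constructive_indefinite_description _ (ev q))) => q.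
  exact: proj2_sig (constructive_indefinite_description _ (ev q)).
pose N := (\max_q f q).+1.
have mesh u v w x : e u v -> e w x -> u != w -> u != x -> v != w -> v != x ->
    fine_mesh N (arc u v) (arc w x).
  move=> uv wx uw ux vw vx; apply: (Hf (u, v, (w, x))).
    by apply: leqW; apply: leq_bigmax.
  by rewrite uv wx uw ux vw vx.
pose lt (u v : T) := enum_rank u < enum_rank v.
(* [arc u v] and [arc v u] may be different curves; the rank selects one of them, which makes [k]
   symmetric. *)
pose k w u v := if lt u v then winding N (arc u v) (pos w)
                else winding N (arc v u) (pos w).
have kC w u v : k w u v = k w v u.
  rewrite /k /lt; case: (ltngtP (enum_rank u) (enum_rank v)) => // E.
  by have -> : u = v by apply: enum_rank_inj; apply: val_inj.
exists (fun a b => upper (psub (pos a) (pos b))), k; split.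
- by move=> a b ab; apply: upper_opp => /injp E; rewrite E eqxx in ab.
- exact: kC.
have key u v w x : lt u v -> lt w x -> e u v -> e w x -> u != w -> u != x -> v != w -> v != x ->
    k w u v (+) k x u v (+) (k u w x (+) k v w x) =
    upper (psub (pos w) (pos u)) (+) upper (psub (pos x) (pos u)) (+)
    (upper (psub (pos w) (pos v)) (+) upper (psub (pos x) (pos v))).
  move=> luv lwx uv wx uw ux vw vx; rewrite /k luv lwx.
  have [_ [g0 [g1 _]]] := H u v uv; have [_ [h0 [h1 _]]] := H w x wx.
  by have := winding_boundary (isT : 0 < N) (mesh _ _ _ _ uv wx uw ux vw vx); rewrite g0 g1 h0 h1.
have ltN u v : e u v -> lt u v \/ lt v u.
  move=> uv; rewrite /lt; case: (ltngtP (enum_rank u) (enum_rank v)) => // E; auto.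
  have Euv : u = v by apply: enum_rank_inj; apply: val_inj.
  by move: uv; rewrite Euv (negPf (ie v)).
move=> u v w x uv wx uw ux vw vx.
have vu : e v u by rewrite -se. have xw : e x w by rewrite -se.
case: (ltN u v uv) (ltN w x wx) => [l1|l1] [l2|l2].
- exact: key.
- have := key u v x w l1 l2 uv xw ux uw vx vw; rewrite (kC u x) (kC v x).
  by do 4 case: (k _ _ _); do 4 case: (upper _).
- have := key v u w x l1 l2 vu wx vw vx uw ux; rewrite (kC w v) (kC x v).
  by do 4 case: (k _ _ _); do 4 case: (upper _).
- have := key v u x w l1 l2 vu xw vx vw ux uw.
  rewrite (kC w v) (kC x v) (kC u x) (kC v x).
  by do 4 case: (k _ _ _); do 4 case: (upper _).
Qed.

(** * Special 2-paths *)

Section Types.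
Variables m n : nat.

Definition type_code (a : adj_type m n) : 'I_m + 'I_m + 'I_n :=
  match a with AOut i => inl (inl i) | AIn i => inl (inr i) | AEdge j => inr j end.

Definition type_decode (a : 'I_m + 'I_m + 'I_n) : adj_type m n :=
  match a with
  | inl (inl i) => AOut n i | inl (inr i) => AIn n i | inr j => AEdge m j
  end.

Lemma type_codeK : cancel type_code type_decode. Proof. by case. Qed.
Lemma type_decodeK : cancel type_decode type_code. Proof. by case=> [[]|]. Qed.

Lemma flip_typeK : involutive (@flip_type m n). Proof. by case. Qed.

Lemma card_type_code : #|{: 'I_m + 'I_m + 'I_n}| = 2 * m + n.
Proof. by rewrite !card_sum !card_ord mul2n addnn. Qed.

Variables (T : finType) (e : rel T) (c : T -> T -> adj_type m n) (R : {set T}).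

Lemma sees_relative_clique :
  (forall u v, u \in R -> v \in R -> u != v ->
     e u v \/ exists z, [/\ e z u, e z v & c z u <> c z v]) ->
  relative_clique e c R.
Proof.
move=> H T' e' c' f [[ie' _] _] hom u v uR vR /eqP uv fuv.
have [euv|[z [zu zv cc]]] := H u v uR vR uv.
  by have [] := hom u v euv; rewrite fuv (negPf (ie' _)).
by apply: cc; have [_ <-] := hom z u zu; have [_ <-] := hom z v zv; rewrite fuv.
Qed.

(* If u and v are neither adjacent nor joined by a special 2-path, then mapping v
   to u is a homomorphism to the graph in which the two vertices are identified. *)
Lemma relative_clique_sees : colored_mixed_graph e c -> relative_clique e c R ->
  forall u v, u \in R -> v \in R -> u != v ->
  e u v \/ exists z, [&& e z u, e z v & type_code (c z u) != type_code (c z v)].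
Proof.
move=> [[ie se] fl] rc u v uR vR uv.
have [euv|neuv] := boolP (e u v); first by left.
have [/existsP|nsp] := boolP
  [exists z, [&& e z u, e z v & type_code (c z u) != type_code (c z v)]]; first by right.
exfalso.
have same z : e z u -> e z v -> c z u = c z v.
  move=> zu zv; apply: (can_inj type_codeK); apply/eqP; apply: contraNT nsp => cc.
  by apply/existsP; exists z; rewrite zu zv.
have nevu : ~~ e v u by rewrite se.
pose f x := if x == v then u else x.
pose e' x y := [&& x != v, y != v & [|| e x y, (x == u) && e v y | (y == u) && e v x]].
(* A new edge at [u] takes its type from the edge at [v]; where [u] has that edge already, [same]
   makes the types agree. *)
pose c' x y := if e x y then c x y else if x == u then c v y else c x v.
have hc' : colored_mixed_graph e' c'.
  split; first split.
  - move=> x; rewrite /e' (negPf (ie x)) /= orbb; apply/negP => /and4P[_ _ /eqP -> vu].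
    by rewrite vu in nevu.
  - move=> x y; rewrite /e' se [X in _ || X]orbC.
    by case: (x == v); case: (y == v).
  move=> x y /and3P[xv yv /or3P[xy|/andP[/eqP xu vy]|/andP[/eqP yu vx]]];
    rewrite /c' (se y x).
  - by rewrite xy fl.
  - case: ifP => xy; first by rewrite fl.
    have yu : y != u by apply: contraTneq vy => ->.
    by rewrite xu eqxx (negPf yu) fl // flip_typeK.
  - case: ifP => xy; first by rewrite fl.
    have xu : x != u by apply: contraTneq vx => ->.
    by rewrite yu eqxx (negPf xu) fl // se.
have hf : colored_hom e c e' c' f.
  move=> x y xy; rewrite /f /e' /c'.
  have [xv|xv] := eqVneq x v.
    have yv : y != v by apply: contraTneq xy => ->; rewrite xv ie.
    rewrite (negPf yv) uv yv eqxx -xv xy orbT; split=> //.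
    case: ifP => // uy; have yu : e y u by rewrite se.
    have yx : e y x by rewrite se.
    by rewrite (fl _ _ yu) (fl _ _ yx) xv same // -xv.
  have [yv|yv] := eqVneq y v.
    have vx : e v x by rewrite se -yv.
    rewrite uv xv eqxx vx !orbT; split=> //; rewrite yv in xy *.
    case: ifP => [xu|_]; first exact: same.
    have xu : x != u by apply: contraTneq vx => ->.
    by rewrite (negPf xu).
  by rewrite xv yv xy.
by apply: (rc _ e' c' f hc' hf u v uR vR); rewrite /f ?eqxx ?(negPf uv) //; apply/eqP.
Qed.
End Types.

(** * Straight-line drawings of fans *)

Definition segment (a b : R * R) (t : R) : R * R :=
  (a.1 + t * (b.1 - a.1), a.2 + t * (b.2 - a.2))%RR.

Lemma segment_cont a b : cont01 (segment a b).
Proof.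
move=> t _ eps e0; set M := (Rabs (b.1 - a.1) + Rabs (b.2 - a.2) + 1)%RR.
have p1 := Rabs_pos (b.1 - a.1); have p2 := Rabs_pos (b.2 - a.2).
have M0 : (0 < M)%RR by rewrite /M; lra.
exists (eps / M)%RR; split; first by apply: Rdiv_lt_0_compat.
move=> s _ st; have {}st : (Rabs (s - t) * M < eps)%RR.
  have := Rmult_lt_compat_r _ _ _ M0 st.
  by have -> : (eps / M * M = eps)%RR by field; lra.
have p3 := Rabs_pos (s - t).
have dist u v : (u + s * (v - u) - (u + t * (v - u)) = (s - t) * (v - u))%RR by ring.
by split; rewrite /segment /= dist Rabs_mult; apply: Rle_lt_trans st;
  apply: Rmult_le_compat_l => //; rewrite /M; lra.
Qed.

Lemma segment_inj a b s t : a <> b -> segment a b s = segment a b t -> s = t.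
Proof.
case: a b => [a1 a2] [b1 b2] ab [/= E1 E2].
have [H1|H1] := Req_dec a1 b1; last first.
  by apply: (Rmult_eq_reg_r (b1 - a1)); lra.
have [H2|H2] := Req_dec a2 b2; first by case: ab; rewrite H1 H2.
by apply: (Rmult_eq_reg_r (b2 - a2)); lra.
Qed.

(* The integer a is placed at (a, a^2), so that edges are chords above the parabola;
   the apex lies so far below that its edges stay under the parabola. *)
Section Fan.
Variables (N : nat) (base : rel nat).
Hypothesis base_lt : forall a b, base a b -> a < b.
Hypothesis base_nc : forall a b c d, base a b -> base c d ->
  [|| b <= c, d <= a, (a <= c) && (d <= b) | (c <= a) && (b <= d)].

Definition fan_rel : rel (option 'I_N) := fun u v =>
  match u, v with
  | None, None => false
  | Some a, Some b => base a b || base b a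
  | _, _ => true
  end.

Definition fan_pos (u : option 'I_N) : R * R :=
  if u is Some a then (INR a, INR a * INR a)%RR else (0, - (INR N * INR N) - 1)%RR.

Let M := (INR N * INR N + 1)%RR.

Lemma ordR (a : 'I_N) : (0 <= INR a < INR N)%RR.
Proof. by split; [exact: pos_INR | apply: lt_INR; have := ltn_ord a; lia]. Qed.

Lemma ord_sqr (a b : 'I_N) : (INR a * INR b < M)%RR.
Proof. by have := ordR a; have := ordR b; rewrite /M; nra. Qed.

Lemma fan_pos_inj : injective fan_pos.
Proof.
move=> [a|] [b|] //= [].
- by move=> /INR_eq E _; congr Some; apply: val_inj.
- by move=> _; have := ord_sqr a a; rewrite /M; have := ordR a; nra.
- by move=> _; have := ord_sqr b b; rewrite /M; have := ordR b; nra.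
Qed.

Definition on_spoke (a : 'I_N) (q : R * R) : Prop :=
  exists2 s, in01o s & q = (s * INR a, - M + s * (INR a * INR a + M))%RR.

(** The chord of the parabola, written as the parabola plus an excess that is positive between the
    ends. *)
Definition on_chord (a b : nat) (q : R * R) : Prop :=
  (INR a < q.1 < INR b)%RR /\ q.2 = (q.1 * q.1 + (q.1 - INR a) * (INR b - q.1))%RR.

Lemma spoke_below a q : on_spoke a q -> (- M < q.2 < q.1 * q.1)%RR.
Proof.
move=> [s [s0 s1] ->] /=; have := ord_sqr a a; have [a0 _] := ordR a => aM.
have aa : (0 <= INR a * INR a)%RR by apply: Rmult_le_pos.
split; first by have := Rmult_lt_0_compat _ _ s0 (_ : 0 < INR a * INR a + M)%RR; lra.
(* This product is the gap q.1 * q.1 - q.2. *)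
have h : (0 < (1 - s) * (M - s * (INR a * INR a)))%RR.
  by apply: Rmult_lt_0_compat; nra.
by nra.
Qed.

Lemma chord_above a b q : on_chord a b q -> (q.1 * q.1 < q.2)%RR.
Proof.
move=> [[h1 h2] ->].
have := Rmult_lt_0_compat (q.1 - INR a) (INR b - q.1); lra.
Qed.

(** The directions (a, a^2 + M) and (b, b^2 + M) have determinant (a - b)(M - ab), non-zero for
    distinct a, b because ab < M. *)
Lemma spoke_disjoint a b q : on_spoke a q -> on_spoke b q -> a = b.
Proof.
move=> [s [s0 s1] ->] [t [t0 t1] [E1 E2]].
have aM := ord_sqr a b; have [a0 _] := ordR a; have [b0 _] := ordR b.
have [E|ne] := Req_dec (INR a) (INR b); first by apply/val_inj/INR_eq.
exfalso.
have E3 : (s * (INR a * INR a + M) = t * (INR b * INR b + M))%RR by lra.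
have : (s * ((INR a - INR b) * (M - INR a * INR b)) = 0)%RR.
  have -> : (s * ((INR a - INR b) * (M - INR a * INR b)) =
     (s * INR a) * (INR b * INR b + M) - INR b * (s * (INR a * INR a + M)))%RR by ring.
  by rewrite E3 E1; ring.
by case/Rmult_integral => [|/Rmult_integral []]; lra.
Qed.

(** For nested chords the excesses differ by (k - i)(j - x) + (j - l)(x - k), whose terms are
    non-negative and vanish together only if the ends agree. *)
Lemma chord_disjoint a b c d q : base a b -> base c d ->
  on_chord a b q -> on_chord c d q -> a = c /\ b = d.
Proof.
move=> ab cd [[h1 h2] E] [[h3 h4] E']; rewrite E in E'.
have nest (i j k l : nat) : i <= k -> l <= j ->
    (INR i < q.1 < INR j)%RR -> (INR k < q.1 < INR l)%RR ->
    (q.1 * q.1 + (q.1 - INR i) * (INR j - q.1) =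
     q.1 * q.1 + (q.1 - INR k) * (INR l - q.1))%RR -> i = k /\ j = l.
  move=> /leP/le_INR ik /leP/le_INR lj [k1 k2] [k3 k4] K.
  have p1 : (0 <= (INR k - INR i) * (INR j - q.1))%RR by apply: Rmult_le_pos; lra.
  have p2 : (0 <= (INR j - INR l) * (q.1 - INR k))%RR by apply: Rmult_le_pos; lra.
  have q1 : ((INR k - INR i) * (INR j - q.1) = 0)%RR by nra.
  have q2 : ((INR j - INR l) * (q.1 - INR k) = 0)%RR by nra.
  by split; apply: INR_eq;
    [case/Rmult_integral: q1 | case/Rmult_integral: q2]; lra.
case/or4P: (base_nc ab cd).
- by move=> /leP/le_INR; lra.
- by move=> /leP/le_INR; lra.
- by case/andP=> ac db; apply: nest.
- by case/andP=> ca bd; have [] := nest c d a b ca bd; auto.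
Qed.

Lemma fan_edge u v t : fan_rel u v -> in01o t ->
  let q := segment (fan_pos u) (fan_pos v) t in
  (exists2 a, on_spoke a q & (u, v) = (None, Some a) \/ (u, v) = (Some a, None)) \/
  (exists2 ab : 'I_N * 'I_N, base ab.1 ab.2 /\ on_chord ab.1 ab.2 q &
    (u, v) = (Some ab.1, Some ab.2) \/ (u, v) = (Some ab.2, Some ab.1)).
Proof.
move=> uv [t0 t1].
have chord (a b : 'I_N) : base a b ->
   on_chord a b (segment (fan_pos (Some a)) (fan_pos (Some b)) t) /\
   on_chord a b (segment (fan_pos (Some b)) (fan_pos (Some a)) t).
  move=> /base_lt/ltP/lt_INR ab; rewrite /on_chord /segment /=.
  have p1 : (0 < t * (INR b - INR a))%RR by apply: Rmult_lt_0_compat; lra.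
  have p2 : (0 < (1 - t) * (INR b - INR a))%RR by apply: Rmult_lt_0_compat; lra.
  by split; (split; [lra | ring]).
case: u v uv => [a|] [b|] //=.
- case/orP=> ab; right; have [c1 c2] := chord _ _ ab.
    by exists (a, b) => //; left.
  by exists (b, a) => //; right.
- move=> _; left; exists a; last by right.
  exists (1 - t)%RR; first by split; lra.
  by rewrite /segment /M /=; congr (_, _); ring.
- move=> _; left; exists b; last by left.
  exists t; first by split.
  by rewrite /segment /M /=; congr (_, _); ring.
Qed.

Lemma fan_planar : planar fan_rel.
Proof.
exists fan_pos, (fun u v => segment (fan_pos u) (fan_pos v)); split; first exact: fan_pos_inj.
move=> u v uv; split; first exact: segment_cont.
split; first by rewrite /segment !Rmult_0_l !Rplus_0_r; case: (fan_pos u).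
split.
  rewrite /segment !Rmult_1_l; case: (fan_pos u) (fan_pos v) => [? ?] [? ?] /=.
  by congr (_, _); ring.
split.
  move=> s t _ _; apply: segment_inj => /fan_pos_inj E; move: uv; rewrite E.
  by case: (v) => //= a; rewrite orbb => /base_lt; rewrite ltnn.
split.
  move=> t w t01 E; have := fan_edge uv t01; rewrite E => -[[a sp _]|[[a b] [_ ch] _]].
    by have := spoke_below sp; case: w {E sp} => [c|] /=; rewrite /M; lra.
  have := chord_above ch; case: w {E ch} => [c|] /=; first lra.
  by have := ordR a; nra.
move=> w x wx ne s t s01 t01 E; apply: ne.
have := fan_edge uv s01; have := fan_edge wx t01; rewrite -E.
case=> [[a sp Ea]|[[a b] [ab ch] Ea]] [[a' sp' Ea']|[[a' b'] [ab' ch'] Ea']].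
- have aa := spoke_disjoint sp sp'; subst a'.
  by case: Ea => [] [-> ->]; case: Ea' => [] [-> ->]; auto.
- by have := spoke_below sp; have := chord_above ch'; lra.
- by have := spoke_below sp'; have := chord_above ch; lra.
- have [/= aa bb] := chord_disjoint ab ab' ch ch'.
  have {}aa : a = a' := val_inj aa. have {}bb : b = b' := val_inj bb. subst a' b'.
  by case: Ea => [] [-> ->]; case: Ea' => [] [-> ->]; auto.
Qed.

Lemma fan_simple : simple_graph fan_rel.
Proof.
split=> [[a|]|[a|] [b|]] //=; last by rewrite orbC.
by apply/negP; rewrite orbb => /base_lt; rewrite ltnn.
Qed.
End Fan.

(** * The extremal construction *)

Section LowerBound.
Variables m n : nat.
Let p := 2 * m + n.
Hypothesis p2 : 1 < p.
Let q := (3 * p).+1.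

(* Each block of q consecutive integers is a hub (residue 0) followed by p triples;
   the hub is joined to the whole block, and each triple is a path. *)
Definition block_rel : rel nat := fun a b =>
  [&& a < b, a %/ q == b %/ q &
      (a %% q == 0) || (b == a.+1) && ((a %% q) %% 3 != 0)].

Lemma block_rel_lt a b : block_rel a b -> a < b. Proof. by case/and3P. Qed.

Lemma block_rel_nc a b c d : block_rel a b -> block_rel c d ->
  [|| b <= c, d <= a, (a <= c) && (d <= b) | (c <= a) && (b <= d)].
Proof.
move=> /and3P[ab /eqP ab' hab] /and3P[cd /eqP cd' hcd].
case/orP: hab => [/eqP a0|/andP[/eqP b1 _]]; last by lia.
case/orP: hcd => [/eqP c0|/andP[/eqP d1 _]]; last by lia.
have Ea := divn_eq a q; have Ec := divn_eq c q.
have Eb := divn_eq b q; have Ed := divn_eq d q.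
have rb : b %% q < q by rewrite ltn_mod. have rd : d %% q < q by rewrite ltn_mod.
rewrite a0 addn0 in Ea; rewrite c0 addn0 in Ec; rewrite -ab' in Eb; rewrite -cd' in Ed.
case: (ltngtP (a %/ q) (c %/ q)) => h.
- by have := leq_mul h (leqnn q); rewrite mulSn; lia.
- by have := leq_mul h (leqnn q); rewrite mulSn; lia.
- have -> : a = c by rewrite Ea h -Ec.
  by clear; lia.
Qed.

Let V := option 'I_(p * q).
Let edge : rel V := @fan_rel (p * q) block_rel.

Variable c0 : 'I_m + 'I_m + 'I_n.
(** [c0] is only the default of [nth]: the indices used are below p. *)
Definition ith_type (k : nat) : adj_type m n :=
  type_decode (nth c0 (enum {: 'I_m + 'I_m + 'I_n}) k).

Lemma ith_type_inj i j : i < p -> j < p -> ith_type i = ith_type j -> i = j.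
Proof.
move=> ip jp /(can_inj (@type_decodeK m n))/eqP.
by rewrite nth_uniq ?enum_uniq -?cardE ?card_type_code // => /eqP.
Qed.

(** The type seen from the smaller end, the apex being smallest. The flip makes the middle of a
    triple see type 0 at one end and type 1 at the other, two types because p > 1. *)
Definition oriented_type (u v : V) : adj_type m n :=
  match u, v with
  | None, Some a => ith_type (a %/ q)
  | Some a, Some b =>
      if a %% q == 0 then ith_type ((b %% q).-1 %/ 3)
      else if (a %% q) %% 3 == 1 then flip_type (ith_type 0) else ith_type 1
  | _, _ => ith_type 0
  end.

Definition oriented (u v : V) : bool :=
  match u, v with None, Some _ => true | Some a, Some b => a < b | _, _ => false end.

Definition fan_type (u v : V) : adj_type m n :=
  if oriented u v then oriented_type u v else flip_type (oriented_type v u).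

Lemma fan_colored : colored_mixed_graph edge fan_type.
Proof.
split; first exact: fan_simple block_rel_lt.
move=> u v uv; rewrite /fan_type.
have -> : oriented v u = ~~ oriented u v.
  case: u v uv => [a|] [b|] //=; rewrite -leqNgt => /orP[]/block_rel_lt; lia.
by case: (oriented u v); rewrite //= flip_typeK.
Qed.

Lemma ord_block (a : 'I_(p * q)) : a %/ q < p.
Proof. by rewrite ltn_divLR. Qed.

Lemma triple_lt r : r < q -> r.-1 %/ 3 < p.
Proof. by move=> rq; rewrite ltn_divLR //; move: rq; rewrite /q; lia. Qed.

Lemma triple_cases r s : r != 0 -> r < s -> r.-1 %/ 3 = s.-1 %/ 3 ->
  s = r.+1 /\ r %% 3 != 0 \/ s = r.+2 /\ r %% 3 = 1.
Proof. by clear; lia. Qed.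

(** Different blocks are joined through the apex, different triples of a block through its hub, and
    the ends of a triple through its middle; all other pairs are adjacent. *)
Lemma fan_clique : relative_clique edge fan_type [set: V].
Proof.
apply: sees_relative_clique => u v _ _.
have [eds _] := fan_colored; case: eds => _ es.
wlog : u v / oriented u v || (u == v).
  move=> W uv; have : oriented u v || oriented v u.
    case: u v uv {W} => [a|] [b|] //=; rewrite -neq_ltn.
    by apply: contraNneq => /val_inj ->.
  case/orP=> o; first by apply: W; rewrite ?o.
  have [||vu|[z [zv zu cc]]] := W v u; rewrite ?o // 1?eq_sym //.
    by left; rewrite es.
  by right; exists z; split=> // E; apply: cc.
move=> /orP[o|/eqP->]; last by rewrite eqxx.
case: u v o => [a|] [b|] //=; last by left.
move=> ab _.
have [blk|blk] := eqVneq (a %/ q) (b %/ q); last first.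
  right; exists None; split=> //; rewrite /fan_type /= => /ith_type_inj E.
  by move/eqP: blk; apply; apply: E; apply: ord_block.
have [a0|a0] := eqVneq (a %% q) 0.
  by left; rewrite /= /block_rel ab blk a0 eqxx.
have Ea := divn_eq a q; have Eb := divn_eq b q.
have ra : a %% q < q by rewrite ltn_mod. have rb : b %% q < q by rewrite ltn_mod.
have bE : b + a %% q = a + b %% q.
  by rewrite {1}Eb {2}Ea blk addnAC.
have rab : a %% q < b %% q by rewrite -(ltn_add2l a) -bE ltn_add2r.
have hub_lt : a %/ q * q < p * q.
  by apply: leq_ltn_trans (ltn_ord a); apply: leq_trunc_div.
pose hub : 'I_(p * q) := Ordinal hub_lt.
have hub0 : hub %% q = 0 by rewrite /= modnMl.
have hubd : hub %/ q = a %/ q by rewrite /= mulnK.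
have [tri|tri] := eqVneq ((a %% q).-1 %/ 3) ((b %% q).-1 %/ 3); last first.
  have ha : hub < a by rewrite [ltnRHS]Ea -[ltnLHS]addn0 ltn_add2l lt0n.
  have hb : hub < b := ltn_trans ha ab.
  right; exists (Some hub); split.
  - by rewrite /= /block_rel ha hubd hub0 !eqxx.
  - by rewrite /= /block_rel hb hubd hub0 blk !eqxx.
  rewrite /fan_type /oriented ha hb /oriented_type hub0 eqxx => /ith_type_inj E.
  by move/eqP: tri; apply; apply: E; apply: triple_lt.
have [[s1 r3]|[s2 a3]] := triple_cases a0 rab tri.
  have b1 : b = a.+1 :> nat by move: bE; rewrite s1; clear; lia.
  by left; rewrite /= /block_rel ab blk b1 r3 !eqxx /= orbT.
have b2 : b = a.+2 :> nat by move: bE; rewrite s2; clear; lia.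
have mid_lt : a.+1 < p * q by apply: leq_ltn_trans (ltn_ord b); rewrite b2.
pose mid : 'I_(p * q) := Ordinal mid_lt.
have midd : mid %/ q = a %/ q.
  apply/eqP; rewrite eqn_leq; apply/andP; split; last exact: leq_div2r.
  by rewrite blk; apply: leq_div2r; rewrite /= b2.
have midm : mid %% q = (a %% q).+1.
  apply: (@addnI (a %/ q * q)); rewrite -{1}midd -divn_eq /= addnS.
  by rewrite -divn_eq.
have mid3 : (mid %% q) %% 3 = 2 by rewrite midm -addn1 -modnDml a3.
right; exists (Some mid); split.
- by rewrite /= /block_rel /= ltnSn midd a3 !eqxx /= !orbT.
- by rewrite /= /block_rel /= b2 ltnSn midd blk b2 mid3 !eqxx /= orbT.
rewrite /fan_type /oriented /= ltnNge leqnSn /= b2 ltnSn /oriented_type.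
rewrite (negPf a0) a3 eqxx flip_typeK midm /=.
have -> : ((a %% q).+1 %% 3 == 1) = false by rewrite -midm mid3.
by move/ith_type_inj => E; suff : 0 = 1 by []; apply: E; rewrite // ltnW.
Qed.
End LowerBound.

(* omega_{r(m,n)}(planar graphs) lies in [3p^2+p+1, 42p^2+8], p = 2m+n > 1 *)
Theorem mainTheorem4 (m n : nat) (hp : 1 < 2 * m + n) :
  let p := 2 * m + n in
  (exists (T : finType) (e : rel T) (c : T -> T -> adj_type m n) (Rc : {set T}),
      colored_mixed_graph e c /\ planar e /\ relative_clique e c Rc /\
      3 * p ^ 2 + p + 1 <= #|Rc|)
  /\
  (forall (T : finType) (e : rel T) (c : T -> T -> adj_type m n) (Rc : {set T}),
      colored_mixed_graph e c -> planar e -> relative_clique e c Rc ->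
      #|Rc| <= 42 * p ^ 2 + 8).
Proof.
move=> p; split.
  have /card_gt0P[c0 _] : 0 < #|{: 'I_m + 'I_m + 'I_n}| by rewrite card_type_code; lia.
  exists _, (@fan_rel (p * (3 * p).+1) (block_rel m n)), (fan_type c0), [set: _].
  split; first exact: fan_colored.
  split; first by apply: fan_planar; [exact: block_rel_lt | exact: block_rel_nc].
  split; first exact: fan_clique.
  by rewrite cardsT card_option card_ord -/p; nia.
move=> T e c Rc cm pl rc; rewrite /p -card_type_code.
apply: (clique_bound (planar_drawable cm.1 pl) (relative_clique_sees cm rc)).
by rewrite card_type_code.
Qed.
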